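(* Let $\mathsf{A}\subset GL_2(\mathbb{R})$ and let $\mathcal{S}(\mathsf{A})$ be the sub-semigroup of $GL_2(\mathbb{R})$ generated by $\mathsf{A}$. If $\mathcal{S}(\mathsf{A})$ is almost multiplicative, then exactly one of the two following conditions holds: (1) $\mathsf{A}$ is strongly conformal; (2) $\mathsf{A}$ has an invariant unstable multicone and $\mathcal{S}(\mathsf{A})$ does not contain parabolic elements.
   Context: $\|\cdot\|$ denotes the operator norm. $\mathcal{S}(\mathsf{A})=\{A_1\cdots A_n : n\in\mathbb{N},\ A_i\in\mathsf{A}\}$. A semigroup $\mathcal{S}\subset GL_2(\mathbb{R})$ is almost multiplicative if there is $\kappa>0$ with $\|AB\|\ge\kappa\|A\|\|B\|$ for all $A,B\in\mathcal{S}$. A matrix is proximal if it has two real eigenvalues with distinct absolute values; parabolic if it has only one eigenspace (the single eigenvalue has geometric multiplicity one); conformal if its two eigenvalues have the same absolute value, equivalently there is an invertible $M$ with $|\det A|^{-1/2}MAM^{-1}\in O(2)$. A set $\mathsf{A}\subset GL_2(\mathbb{R})$ is strongly conformal if there is a single invertible $M$ with $|\det A|^{-1/2}MAM^{-1}\in O(2)$ for all $A\in\mathsf{A}$. $\mathbb{RP}^1$ is the real projective line (lines through the origin in $\mathbb{R}^2$), on which $GL_2(\mathbb{R})$ acts. A multicone is a proper subset of $\mathbb{RP}^1$ that is a finite union of closed projective intervals; it is invariant for $\mathsf{A}$ if $A\mathcal{C}\subset\mathcal{C}$ for all $A\in\mathsf{A}$. For a proximal $A$, $u(A)$ and $s(A)$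 denote the eigenspaces of the eigenvalues of largest and smallest absolute value. $X_u(\mathsf{A})=\overline{\{u(A):A\in\mathcal{S}(\mathsf{A})\text{ proximal}\}}$, $X_s(\mathsf{A})=\overline{\{s(A):A\in\mathcal{S}(\mathsf{A})\text{ proximal}\}}$. A multicone $\mathcal{C}$ is an unstable multicone for $\mathsf{A}$ if $\mathcal{S}(\mathsf{A})$ contains at least one proximal element and: $\mathcal{C}\cap X_s(\mathsf{A})=\emptyset$; $\partial\mathcal{C}\cap X_u(\mathsf{A})=\emptyset$; each connected component of $\mathcal{C}$ intersects $X_u(\mathsf{A})$. *)

(* Defs.v *)
From HB Require Import structures.
From mathcomp Require Import all_boot all_order all_algebra.
From mathcomp Require Import all_classical all_reals all_analysis.
Set Implicit Arguments. Unset Strict Implicit. Unset Printing Implicit Defensive.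
Import Order.TTheory GRing.Theory Num.Theory.
Import numFieldNormedType.Exports.
Local Open Scope classical_set_scope.
Local Open Scope ring_scope.

Section Defs.
Variable R : realType.
Local Notation mat := 'M[R]_2.
Local Notation vec := 'cV[R]_2.

Definition vx (v : vec) : R := v ord0 ord0.
Definition vy (v : vec) : R := v (lift ord0 ord0) ord0.
Definition mkv (x y : R) : vec := \col_(i < 2) (if i == ord0 then x else y).

Definition enorm (v : vec) : R := Num.sqrt (vx v ^+ 2 + vy v ^+ 2).
Definition opnorm (A : mat) : R :=
  sup [set enorm (A *m v) | v in [set v : vec | enorm v = 1]].

Inductive semigroup (A : set mat) : mat -> Prop :=
| sg_gen a : A a -> semigroup A a
| sg_mul a b : A a -> semigroup A b -> semigroup A (a *m b).

Definition almost_multiplicative (S : set mat) : Prop :=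
  exists2 k : R, 0 < k &
    forall a b, S a -> S b -> opnorm (a *m b) >= k * opnorm a * opnorm b.

Definition eigenpair (A : mat) (l : R) (v : vec) : Prop := v != 0 /\ A *m v = l *: v.

Definition proximal (A : mat) : Prop :=
  exists l1 l2 v1 v2, [/\ eigenpair A l1 v1, eigenpair A l2 v2 & `|l1| != `|l2|].

Definition parabolic (A : mat) : Prop :=
  exists v : vec, (exists l, eigenpair A l v) /\
    forall l w, eigenpair A l w -> exists c : R, w = c *: v.

Definition strongly_conformal (A : set mat) : Prop :=
  exists2 M : mat, M \in unitmx & forall a, A a ->
    let Q := (Num.sqrt `|\det a|)^-1 *: (M *m a *m invmx M) in Q *m Q^T = 1%:M.

(* Model of RP^1: the line through v <> 0 is sent to the point
   ((x^2-y^2)/(x^2+y^2), 2xy/(x^2+y^2)) of the unit circle (angle doubling),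
   a homeomorphism RP^1 ~ S^1.  Subsets of RP^1 are subsets of S1. *)
Definition S1 : set (R * R) := [set p | p.1 ^+ 2 + p.2 ^+ 2 = 1].
Definition line (v : vec) : R * R :=
  let x := vx v in let y := vy v in
  ((x ^+ 2 - y ^+ 2) / (x ^+ 2 + y ^+ 2), 2 * x * y / (x ^+ 2 + y ^+ 2)).

Definition pinterval (a b : R) : set (R * R) :=
  [set line (mkv (cos t) (sin t)) | t in `[a, b]].

Definition multicone (C : set (R * R)) : Prop :=
  [/\ C `<=` S1, C != S1 &
      exists s : seq (R * R), s != [::] /\
        (forall ab, ab \in s -> ab.1 <= ab.2) /\
        C = \bigcup_(ab in [set ab | ab \in s]) pinterval ab.1 ab.2].

Definition invariant_for (A : set mat) (C : set (R * R)) : Prop :=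
  forall a v, A a -> v != 0 -> C (line v) -> C (line (a *m v)).

Definition pinterior (C : set (R * R)) : set (R * R) :=
  [set x | C x /\ exists2 e : R, 0 < e & forall y : R * R, `|y.1 - x.1| < e -> `|y.2 - x.2| < e -> S1 y -> C y].
Definition pboundary (C : set (R * R)) : set (R * R) :=
  closure C `\` pinterior C.

Definition is_u (a : mat) (v : vec) : Prop :=
  exists l l' w, [/\ eigenpair a l v, eigenpair a l' w & `|l'| < `|l|].
Definition is_s (a : mat) (v : vec) : Prop :=
  exists l l' w, [/\ eigenpair a l v, eigenpair a l' w & `|l| < `|l'|].

Definition Xu (A : set mat) : set (R * R) :=
  closure [set line v | v in [set v | exists2 a, semigroup A a & is_u a v]].
Definition Xs (A : set mat) : set (R * R) :=
  closure [set line v | v in [set v | exists2 a, semigroup A a & is_s a v]].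

Definition unstable_multicone (A : set mat) (C : set (R * R)) : Prop :=
  [/\ multicone C,
      exists2 a, semigroup A a & proximal a,
      C `&` Xs A = set0,
      pboundary C `&` Xu A = set0 &
      forall x, C x -> connected_component C x `&` Xu A !=set0].

End Defs.

(* Main.v *)
Require Import Defs.
From HB Require Import structures.
From mathcomp Require Import all_boot all_order all_algebra.
From mathcomp Require Import all_classical all_reals all_analysis.
From mathcomp Require Import ring lra.
Import Order.TTheory GRing.Theory Num.Theory.
Import numFieldNormedType.Exports.
Local Open Scope classical_set_scope.
Local Open Scope ring_scope.

(** Idea. Let S be the semigroup with the identity added, and let G be the
    closure of the cone { c a : c real, a in S }. For the Frobenius norm N the
    inequality N(PQ) >= k N(P) N(Q) passes from S to G, which is again closed
    under products.

    If every nonzero element of G is invertible, compactness bounds |det a| below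
    by d N(a)^2 on S. Among the quadratic forms q with
    q(v) <= sup_{a in S} |a v|^2 / |det a|, the one of maximal determinant is
    unique, hence invariant (up to the factor |det b|) under every b in A: this is
    strong conformality.

    Otherwise G contains rank-one elements u p^T. Their images are limits of
    unstable directions, by perturbing eigenvectors, and for every proximal a the
    rank-one projection along s(a) lies in G. The norm inequality therefore keeps
    P u, P in G, uniformly away from all stable directions, and the same holds for
    P v as soon as v is close to u. The set of all lines P v, with P in G and v in
    a fixed small angular neighbourhood of some such u, is the required multicone:
    it is compact, invariant, contains a neighbourhood of X_u, and each of its
    points is joined inside it to an arc of definite length centred at a point of
    X_u, so it has finitely many components, each meeting X_u.

    A parabolic l + n has powers asymptotic to multiples of n, and n n = 0
    contradicts the norm inequality. *)

(** * Coordinates in dimension two *)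

Section Coordinates.
Set Implicit Arguments. Unset Strict Implicit.
Variable R : realType.
Implicit Types (A B : 'M[R]_2) (u v w : 'cV[R]_2).

Definition M4 (a b c d : R) : 'M[R]_2 :=
  \matrix_(i, j) (if i == ord0 then (if j == ord0 then a else b)
                  else (if j == ord0 then c else d)).

Let i1 : 'I_2 := lift ord0 ord0.

Lemma I2P (i : 'I_2) : i = ord0 \/ i = i1.
Proof. by case: i => [[|[|//]] Hi]; [left|right]; apply: val_inj. Qed.

Lemma M4E A : A = M4 (A ord0 ord0) (A ord0 i1) (A i1 ord0) (A i1 i1).
Proof.
apply/matrixP => i j; rewrite mxE.
by case: (I2P i) => ->; case: (I2P j) => ->.
Qed.

Lemma mkvE v : v = mkv (vx v) (vy v).
Proof.
by apply/matrixP => i j; rewrite mxE ord1 /vx /vy; case: (I2P i) => ->.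
Qed.

(** Reduces a statement about an abstract matrix to its four entries, where [coordE] followed by
    [ring] or [lra] applies. *)
Lemma mat_elim (P : 'M[R]_2 -> Prop) :
  (forall a b c d, P (M4 a b c d)) -> forall A, P A.
Proof. by move=> H A; rewrite (M4E A). Qed.

Lemma vec_elim (P : 'cV[R]_2 -> Prop) :
  (forall x y, P (mkv x y)) -> forall v, P v.
Proof. by move=> H v; rewrite (mkvE v). Qed.

Lemma vx_mkv (x y : R) : vx (mkv x y) = x. Proof. by rewrite /vx mxE. Qed.
Lemma vy_mkv (x y : R) : vy (mkv x y) = y. Proof. by rewrite /vy mxE. Qed.

Lemma M4_inj (a b c d a' b' c' d' : R) : M4 a b c d = M4 a' b' c' d' ->
  [/\ a = a', b = b', c = c' & d = d'].
Proof.
move=> /matrixP H.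
by have := H ord0 ord0; have := H ord0 i1; have := H i1 ord0; have := H i1 i1;
   rewrite !mxE /=.
Qed.

Lemma mkv_inj (x y x' y' : R) : mkv x y = mkv x' y' -> x = x' /\ y = y'.
Proof. by move=> /(congr1 (fun v => (vx v, vy v))); rewrite !vx_mkv !vy_mkv => -[]. Qed.

Lemma mulM4 (a b c d a' b' c' d' : R) : M4 a b c d *m M4 a' b' c' d' =
  M4 (a * a' + b * c') (a * b' + b * d') (c * a' + d * c') (c * b' + d * d').
Proof.
apply/matrixP => i j; rewrite !mxE !big_ord_recl big_ord0 addr0 !mxE /=.
by case: (I2P i) => ->; case: (I2P j) => ->.
Qed.

Lemma mulM4v (a b c d x y : R) :
  M4 a b c d *m mkv x y = mkv (a * x + b * y) (c * x + d * y).
Proof.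
apply/matrixP => i j; rewrite !mxE !big_ord_recl big_ord0 addr0 !mxE /=.
by case: (I2P i) => ->.
Qed.

Lemma addM4 (a b c d a' b' c' d' : R) : M4 a b c d + M4 a' b' c' d' =
  M4 (a + a') (b + b') (c + c') (d + d').
Proof.
by apply/matrixP => i j; rewrite !mxE; case: (I2P i) => ->; case: (I2P j) => ->.
Qed.

Lemma oppM4 (a b c d : R) : - M4 a b c d = M4 (- a) (- b) (- c) (- d).
Proof.
by apply/matrixP => i j; rewrite !mxE; case: (I2P i) => ->; case: (I2P j) => ->.
Qed.

Lemma scaleM4 (k a b c d : R) : k *: M4 a b c d = M4 (k * a) (k * b) (k * c) (k * d).
Proof.
by apply/matrixP => i j; rewrite !mxE; case: (I2P i) => ->; case: (I2P j) => ->.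
Qed.

Lemma trM4 (a b c d : R) : (M4 a b c d)^T = M4 a c b d.
Proof.
by apply/matrixP => i j; rewrite !mxE; case: (I2P i) => ->; case: (I2P j) => ->.
Qed.

Lemma scalarM4 (k : R) : k%:M = M4 k 0 0 k.
Proof.
by apply/matrixP => i j; rewrite !mxE; case: (I2P i) => ->; case: (I2P j) => ->.
Qed.

Lemma zeroM4 : 0 = M4 0 0 0 0 :> 'M[R]_2.
Proof.
by apply/matrixP => i j; rewrite !mxE; case: (I2P i) => ->; case: (I2P j) => ->.
Qed.

Lemma detM4 (a b c d : R) : \det (M4 a b c d) = a * d - b * c.
Proof.
rewrite (expand_det_row _ ord0) !big_ord_recl big_ord0 /cofactor !det_mx11 !mxE /=.
by rewrite !expr1 expr0; ring.
Qed.

Lemma scalemkv (k x y : R) : k *: mkv x y = mkv (k * x) (k * y).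
Proof. by apply/matrixP => i j; rewrite !mxE; case: (I2P i) => ->. Qed.

Lemma addmkv (x y x' y' : R) : mkv x y + mkv x' y' = mkv (x + x') (y + y').
Proof. by apply/matrixP => i j; rewrite !mxE; case: (I2P i) => ->. Qed.

Lemma oppmkv (x y : R) : - mkv x y = mkv (- x) (- y).
Proof. by apply/matrixP => i j; rewrite !mxE; case: (I2P i) => ->. Qed.

Lemma zeromkv : 0 = mkv 0 0 :> 'cV[R]_2.
Proof. by apply/matrixP => i j; rewrite !mxE; case: (I2P i) => ->. Qed.

Definition coordE := (mulM4, mulM4v, addM4, oppM4, scaleM4, trM4, scalarM4, zeroM4,
  detM4, scalemkv, addmkv, oppmkv, zeromkv, vx_mkv, vy_mkv).

(* Squared Euclidean and Frobenius norms: squares keep every estimate polynomial. *)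
Definition nV v := vx v ^+ 2 + vy v ^+ 2.
Definition nM A := A ord0 ord0 ^+ 2 + A ord0 i1 ^+ 2 + A i1 ord0 ^+ 2 + A i1 i1 ^+ 2.
(** For nonzero [u] and [v], [crs] is the product of the norms times the sine of the angle from [u]
    to [v], and [dot] is the same with the cosine. [outer u v] is the rank-one matrix with image [u]
    and row direction [v]. *)
Definition crs u v := vx u * vy v - vy u * vx v.
Definition dot u v := vx u * vx v + vy u * vy v.
Definition outer u v := M4 (vx u * vx v) (vx u * vy v) (vy u * vx v) (vy u * vy v).

Lemma nM_M4 (a b c d : R) : nM (M4 a b c d) = a ^+ 2 + b ^+ 2 + c ^+ 2 + d ^+ 2.
Proof. by rewrite /nM !mxE. Qed.
Lemma nV_mkv (x y : R) : nV (mkv x y) = x ^+ 2 + y ^+ 2.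
Proof. by rewrite /nV !coordE. Qed.

Lemma nV_ge0 v : 0 <= nV v. Proof. by rewrite addr_ge0 ?sqr_ge0. Qed.
Lemma nM_ge0 A : 0 <= nM A. Proof. by rewrite !addr_ge0 ?sqr_ge0. Qed.

Lemma nV_eq0 v : (nV v == 0) = (v == 0).
Proof.
move: v; apply: vec_elim => x y; rewrite nV_mkv.
apply/eqP/eqP => [H|]; last by rewrite zeromkv => /mkv_inj[-> ->]; rewrite expr0n addr0.
have /eqP: x ^+ 2 = 0 by have := sqr_ge0 x; have := sqr_ge0 y; lra.
have /eqP: y ^+ 2 = 0 by have := sqr_ge0 x; have := sqr_ge0 y; lra.
by rewrite !sqrf_eq0 => /eqP -> /eqP ->; rewrite zeromkv.
Qed.

Lemma nM_eq0 A : (nM A == 0) = (A == 0).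
Proof.
move: A; apply: mat_elim => a b c d; rewrite nM_M4.
apply/eqP/eqP => [H|]; last first.
  by rewrite zeroM4 => /M4_inj[-> -> -> ->]; rewrite expr0n !addr0.
have Ha := sqr_ge0 a; have Hb := sqr_ge0 b; have Hc := sqr_ge0 c; have Hd := sqr_ge0 d.
have /eqP: a ^+ 2 = 0 by lra.
have /eqP: b ^+ 2 = 0 by lra.
have /eqP: c ^+ 2 = 0 by lra.
have /eqP: d ^+ 2 = 0 by lra.
by rewrite !sqrf_eq0 => /eqP -> /eqP -> /eqP -> /eqP ->; rewrite zeroM4.
Qed.

Lemma nV_gt0 v : (0 < nV v) = (v != 0).
Proof. by rewrite lt0r nV_eq0 nV_ge0 andbT. Qed.
Lemma nM_gt0 A : (0 < nM A) = (A != 0).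
Proof. by rewrite lt0r nM_eq0 nM_ge0 andbT. Qed.

Lemma nM1 : nM 1%:M = 2.
Proof. by rewrite !coordE nM_M4; ring. Qed.

Lemma nMZ (c : R) A : nM (c *: A) = c ^+ 2 * nM A.
Proof. by move: A; apply: mat_elim => *; rewrite !coordE !nM_M4; ring. Qed.
Lemma nVZ (c : R) v : nV (c *: v) = c ^+ 2 * nV v.
Proof. by move: v; apply: vec_elim => *; rewrite !coordE !nV_mkv; ring. Qed.

Lemma nV_mul A v : nV (A *m v) <= nM A * nV v.
Proof.
move: A v; apply: mat_elim => a b c d; apply: vec_elim => x y.
rewrite !coordE !nV_mkv nM_M4.
have := sqr_ge0 (a * y - b * x); have := sqr_ge0 (c * y - d * x); lra.
Qed.

Lemma nM_outer u v : nM (outer u v) = nV u * nV v.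
Proof.
by move: u v; apply: vec_elim => ? ?; apply: vec_elim => ? ?;
  rewrite nM_M4 !nV_mkv !coordE; ring.
Qed.

Lemma mul_outer A u v : A *m outer u v = outer (A *m u) v.
Proof.
by move: A u v; apply: mat_elim => ? ? ? ?; apply: vec_elim => ? ?;
  apply: vec_elim => ? ?; rewrite /outer !coordE; congr M4; ring.
Qed.

Lemma outer_mulv u v w : outer u v *m w = dot v w *: u.
Proof.
by move: u v w; apply: vec_elim => ? ?; apply: vec_elim => ? ?; apply: vec_elim => ? ?;
  rewrite /outer /dot !coordE; congr mkv; ring.
Qed.

Lemma det_outer u v : \det (outer u v) = 0.
Proof. by rewrite /outer !coordE; ring. Qed.

Lemma outerZ (c : R) u v : outer (c *: u) v = c *: outer u v.
Proof.
by move: u v; apply: vec_elim => ? ?; apply: vec_elim => ? ?;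
  rewrite /outer !coordE; congr M4; ring.
Qed.

(** A column with nonzero top entry spans the image; if the top row vanishes, the bottom row is
    itself the row factor. *)
Lemma det0_outer A : A != 0 -> \det A = 0 ->
  exists u p, [/\ u != 0, p != 0 & A = outer u p].
Proof.
move: A; apply: mat_elim => a b c d A0; rewrite !coordE => D0.
suff [u [p E]] : exists u p, M4 a b c d = outer u p.
  exists u, p; split=> //; apply: contraNN A0 => /eqP H; rewrite E H.
    by rewrite /outer !coordE !mul0r.
  by rewrite /outer !coordE !mulr0.
have [a0|a0] := eqVneq a 0; last first.
  exists (mkv a c), (mkv 1 (b / a)); rewrite /outer !coordE !mulr1; congr M4.
    by field.
  have -> : d = b * c / a by transitivity (a * d / a); [field | congr (_ / _); lra].
  by field.
have [b0|b0] := eqVneq b 0; last first.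
  exists (mkv b d), (mkv (a / b) 1); rewrite /outer !coordE !mulr1; congr M4.
    by rewrite a0; field.
  have -> : c = a * d / b by transitivity (b * c / b); [field | congr (_ / _); lra].
  by field.
exists (mkv 0 1), (mkv c d).
by rewrite /outer !coordE !mul0r !mul1r a0 b0.
Qed.

(** Quarter turn: [dot (orth s) v] equals [crs s v], so for nonzero [w] and [s] the matrix
    [outer w (orth s)] has image [w] and kernel [s]. *)
Definition orth v := mkv (- vy v) (vx v).

(** Only the component of [y] along [orth v], with coefficient [crs v y / nV v], survives
    multiplication by [A]. *)
Lemma sing_kernel A v : v != 0 -> A *m v = 0 -> exists w, forall y, A *m y = crs v y *: w.
Proof.
rewrite -nV_gt0 => v0 Av; exists ((nV v)^-1 *: (A *m orth v)) => y.
move: A v y v0 Av; apply: mat_elim => a b c d; apply: vec_elim => x y; apply: vec_elim => z t.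
rewrite /crs /orth nV_mkv !coordE => n0 /mkv_inj [H1 H2].
have n1 : x ^+ 2 + y ^+ 2 != 0 by rewrite gt_eqF.
congr mkv; rewrite mulrCA; apply: (mulfI n1); rewrite mulVKf //.
  transitivity ((a * z + b * t) * (x ^+ 2 + y ^+ 2) - (x * z + y * t) * (a * x + b * y)).
    by rewrite H1; ring.
  by ring.
transitivity ((c * z + d * t) * (x ^+ 2 + y ^+ 2) - (x * z + y * t) * (c * x + d * y)).
  by rewrite H2; ring.
by ring.
Qed.

End Coordinates.

(** * Lines and norms *)

Section Lines.
Variable R : realType.
Set Implicit Arguments. Unset Strict Implicit.
Implicit Types (A B a b : 'M[R]_2) (u v w : 'cV[R]_2).

(** Angle doubling turns an angle t between two lines into an arc 2t of the circle, whose chord has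
    squared length 4 sin^2 t. Distances in the model are converted to [crs] through this
    identity. *)
Lemma line_dist u v : u != 0 -> v != 0 ->
  ((line u).1 - (line v).1) ^+ 2 + ((line u).2 - (line v).2) ^+ 2
  = 4 * crs u v ^+ 2 / (nV u * nV v).
Proof.
rewrite -!nV_gt0; move: u v; apply: vec_elim => x y; apply: vec_elim => z t.
rewrite /line /crs !nV_mkv !coordE /= => n1 n2.
by field; rewrite !gt_eqF.
Qed.

Lemma line_eq u v : u != 0 -> v != 0 -> crs u v = 0 -> line u = line v.
Proof.
move=> u0 v0 c0; have := line_dist u0 v0; rewrite c0 expr0n mulr0 mul0r => H.
have H1 := sqr_ge0 ((line u).1 - (line v).1).
have H2 := sqr_ge0 ((line u).2 - (line v).2).
have /eqP E1 : ((line u).1 - (line v).1) ^+ 2 = 0 by lra.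
have /eqP E2 : ((line u).2 - (line v).2) ^+ 2 = 0 by lra.
move: E1 E2; rewrite !sqrf_eq0 !subr_eq0 => /eqP E1 /eqP E2.
by rewrite (surjective_pairing (line u)) E1 E2 -surjective_pairing.
Qed.

Lemma line_eq_crs u v : u != 0 -> v != 0 -> line u = line v -> crs u v = 0.
Proof.
move=> u0 v0 E; have := line_dist u0 v0; rewrite E !subrr expr0n addr0.
have n0 : nV u * nV v != 0 by rewrite mulf_neq0 ?nV_eq0.
by move=> /esym/eqP; rewrite mulf_eq0 invr_eq0 (negPf n0) orbF mulf_eq0 sqrf_eq0
  pnatr_eq0 /= => /eqP.
Qed.

Lemma crsZl (c : R) u v : crs (c *: u) v = c * crs u v.
Proof. by move: u v; apply: vec_elim => ? ?; apply: vec_elim => ? ?; rewrite /crs !coordE; ring. Qed.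
Lemma crsZr (c : R) u v : crs u (c *: v) = c * crs u v.
Proof. by move: u v; apply: vec_elim => ? ?; apply: vec_elim => ? ?; rewrite /crs !coordE; ring. Qed.
Lemma crsvv u : crs u u = 0. Proof. by rewrite /crs; ring. Qed.

Lemma lineZ (c : R) v : c != 0 -> v != 0 -> line (c *: v) = line v.
Proof. by move=> c0 v0; apply: line_eq => //; rewrite ?scaler_eq0 ?negb_or ?c0 // crsZl crsvv mulr0. Qed.

Lemma crs_par u v : u != 0 -> crs u v = 0 -> exists c : R, v = c *: u.
Proof.
rewrite -nV_gt0 => n0 c0; exists (dot u v / nV u); move: n0 c0.
move: u v; apply: vec_elim => x y; apply: vec_elim => z t.
rewrite /crs /dot nV_mkv !coordE => n0 c0.
have n1 : x ^+ 2 + y ^+ 2 != 0 by rewrite gt_eqF.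
congr mkv; apply: (mulfI n1); rewrite mulrA [_ * (_ / _)]mulrC divfK //.
  by transitivity ((x * z + y * t) * x - y * (x * t - y * z)); [ring | rewrite c0; ring].
by transitivity ((x * z + y * t) * y + x * (x * t - y * z)); [ring | rewrite c0; ring].
Qed.

Lemma line_S1 v : v != 0 -> S1 (line v).
Proof.
rewrite -nV_gt0; move: v; apply: vec_elim => x y; rewrite nV_mkv /S1 /line !coordE /= => n.
by field; rewrite gt_eqF.
Qed.

Lemma nV_cossin (t : R) : nV (mkv (cos t) (sin t)) = 1.
Proof. by rewrite nV_mkv cos2Dsin2. Qed.

Lemma cossin_neq0 (t : R) : mkv (cos t) (sin t) != 0.
Proof. by rewrite -nV_gt0 nV_cossin. Qed.

Lemma S1_line (z : R * R) : S1 z -> exists2 t, 0 <= t <= pi & z = line (mkv (cos t) (sin t)).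
Proof.
case: z => p q; rewrite /S1 /= => H.
have p1 : -1 <= p <= 1.
  have : p ^+ 2 <= 1 by have := sqr_ge0 q; lra.
  by rewrite -ler_norml -(real_normK (num_real p)) expr_le1.
(* Half-angle formula: [c] is to be the cosine of an angle in [0, pi], where the sine is
   nonnegative, so [c] takes its sign from [q]. *)
have [c [c2 cq]] : exists c : R, c ^+ 2 = (1 + p) / 2 /\ 2 * c * Num.sqrt (1 - c ^+ 2) = q.
  have sq : Num.sqrt ((1 + p) / 2) * Num.sqrt (1 - (1 + p) / 2) = `|q| / 2.
    rewrite -sqrtrM; last by lra.
    have -> : (1 + p) / 2 * (1 - (1 + p) / 2) = (q / 2) ^+ 2.
      transitivity ((1 - p ^+ 2) / 4); first by field.
      transitivity (q ^+ 2 / 4); last by field.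
      by congr (_ / _); lra.
    by rewrite sqrtr_sqr normrM [`|2^-1|]ger0_norm //; lra.
  have s2 : Num.sqrt ((1 + p) / 2) ^+ 2 = (1 + p) / 2 by rewrite sqr_sqrtr //; lra.
  have [q0|q0] := leP 0 q.
    exists (Num.sqrt ((1 + p) / 2)); split=> //.
    by rewrite s2 -mulrA sq ger0_norm // mulrC divfK.
  exists (- Num.sqrt ((1 + p) / 2)); rewrite sqrrN; split=> //.
  by rewrite s2 mulrN mulNr -mulrA sq ltr0_norm // mulNr mulrN opprK mulrC divfK.
have c1 : -1 <= c <= 1.
  by rewrite -ler_norml -(@expr_le1 _ 2%N) // real_normK ?num_real // c2; lra.
exists (acos c); first by rewrite acos_ge0 // acos_lepi.
rewrite /line !coordE acosK ?in_itv //= sin_acos //.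
have s2 : Num.sqrt (1 - c ^+ 2) ^+ 2 = 1 - c ^+ 2 by rewrite sqr_sqrtr // c2; lra.
have d1 : c ^+ 2 + (1 - c ^+ 2) = 1 by ring.
rewrite s2 cq d1 !divr1; congr pair.
by rewrite c2; field.
Qed.

(** * Comparison of the operator norm with the Frobenius norm *)

Lemma enormE v : enorm v = Num.sqrt (nV v). Proof. by []. Qed.
Lemma enorm_sq v : enorm v ^+ 2 = nV v.
Proof. by rewrite enormE sqr_sqrtr // nV_ge0. Qed.

Lemma opnorm_ub A v : enorm v = 1 -> enorm (A *m v) <= opnorm A.
Proof.
move=> v1; apply: sup_ubound; last by exists v.
exists (Num.sqrt (nM A)) => _ [w w1 <-]; rewrite enormE ler_wsqrtr //.
apply: (le_trans (nV_mul _ _)).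
by rewrite -(enorm_sq w) w1 expr1n mulr1.
Qed.

Lemma enorm_mkv10 : enorm (mkv 1 0) = 1 :> R.
Proof. by rewrite enormE nV_mkv expr1n expr0n addr0 sqrtr1. Qed.
Lemma enorm_mkv01 : enorm (mkv 0 1) = 1 :> R.
Proof. by rewrite enormE nV_mkv expr1n expr0n add0r sqrtr1. Qed.

Lemma opnorm_ge0 A : 0 <= opnorm A.
Proof. by apply: le_trans (opnorm_ub A enorm_mkv10); rewrite enormE sqrtr_ge0. Qed.

Lemma opnorm_sq_le A : opnorm A ^+ 2 <= nM A.
Proof.
rewrite -[leRHS]sqr_sqrtr ?nM_ge0 // lerXn2r ?nnegrE ?opnorm_ge0 ?sqrtr_ge0 //.
apply: ge_sup; first by exists (enorm (A *m mkv 1 0)), (mkv 1 0) => //; exact: enorm_mkv10.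
move=> _ [w w1 <-]; rewrite enormE ler_wsqrtr //.
apply: (le_trans (nV_mul _ _)).
by rewrite -(enorm_sq w) w1 expr1n mulr1.
Qed.

(** The two columns are images of unit vectors, so each has squared norm at most [opnorm A ^+ 2]. *)
Lemma nM_le_opnorm A : nM A <= 2 * opnorm A ^+ 2.
Proof.
have -> : nM A = nV (A *m mkv 1 0) + nV (A *m mkv 0 1).
  by move: A; apply: mat_elim => *; rewrite !coordE nM_M4 !nV_mkv; ring.
have H v : enorm v = 1 -> nV (A *m v) <= opnorm A ^+ 2.
  move=> v1; rewrite -enorm_sq lerXn2r ?nnegrE ?opnorm_ge0 ?opnorm_ub //.
  by rewrite enormE sqrtr_ge0.
have := H _ enorm_mkv10; have := H _ enorm_mkv01; lra.
Qed.

End Lines.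

(** * The semigroup *)

Section Semigroup.
Variable R : realType.
Set Implicit Arguments. Unset Strict Implicit.
Implicit Types (A : set 'M[R]_2) (a b : 'M[R]_2) (u v w : 'cV[R]_2).

Definition sg1 A a := semigroup A a \/ a = 1%:M.

Lemma sg_mulmx A a b : semigroup A a -> semigroup A b -> semigroup A (a *m b).
Proof.
by elim=> {a} [a Aa|a c Aa _ IH] Sb; [exact: sg_mul|rewrite -mulmxA; apply: sg_mul => //; exact: IH].
Qed.

Lemma sg1_mulmx A a b : sg1 A a -> sg1 A b -> sg1 A (a *m b).
Proof.
move=> [Sa|->] [Sb|->]; rewrite ?mul1mx ?mulmx1; [left; exact: sg_mulmx|by left|by left|by right].
Qed.

Lemma sg_unitmx A a : (forall a, A a -> a \in unitmx) -> semigroup A a -> a \in unitmx.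
Proof. by move=> H; elim=> {a} [a /H //|a b /H Ha _ Hb]; rewrite unitmx_mul Ha. Qed.

Lemma sg1_unitmx A a : (forall a, A a -> a \in unitmx) -> sg1 A a -> a \in unitmx.
Proof. by move=> H [/(sg_unitmx H)//|->]; rewrite unitmx1. Qed.

Lemma unitmx_det a : (a \in unitmx) = (\det a != 0).
Proof. by rewrite unitmxE unitfE. Qed.

Lemma unitmx_neq0 a v : a \in unitmx -> v != 0 -> a *m v != 0.
Proof.
move=> ua; apply: contraNN => /eqP E.
by rewrite -(mul1mx v) -(mulVmx ua) -mulmxA E mulmx0.
Qed.

Lemma almost_multiplicative_nM A : almost_multiplicative (semigroup A) ->
  exists2 k : R, 0 < k <= 1 / 2 &
    forall a b, sg1 A a -> sg1 A b -> k * nM a * nM b <= nM (a *m b).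
Proof.
(* Changing norms costs a factor 2 for each of [a] and [b], hence [k ^+ 2 / 4]; the cap [1 / 2] is
   what the identity requires, since [nM 1%:M = 2]. *)
move=> [k k0 H]; exists (Num.min (k ^+ 2 / 4) (1 / 2)).
  rewrite lt_min ge_min lexx orbT !andbT divr_gt0 ?exprn_gt0 //=; lra.
have n0 := @nM_ge0 R.
move=> a b [Sa|->] [Sb|->]; rewrite ?mul1mx ?mulmx1 ?nM1.
- have [p0 q0] := (opnorm_ge0 a, opnorm_ge0 b).
  have h : k ^+ 2 * opnorm a ^+ 2 * opnorm b ^+ 2 <= nM (a *m b).
    apply: le_trans (opnorm_sq_le _); rewrite -!exprMn lerXn2r ?nnegrE ?opnorm_ge0 ?H //.
    by rewrite !mulr_ge0 // ltW.
  apply: le_trans h.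
  apply: (@le_trans _ _ (k ^+ 2 / 4 * nM a * nM b)).
    by rewrite -(mulrA (Num.min _ _)) -(mulrA (k ^+ 2 / 4)) ler_wpM2r ?mulr_ge0 // ge_min lexx.
  apply: (@le_trans _ _ (k ^+ 2 / 4 * (2 * opnorm a ^+ 2) * (2 * opnorm b ^+ 2))); last first.
    by rewrite le_eqVlt; apply/orP; left; apply/eqP; field.
  have k4 : 0 <= k ^+ 2 / 4 by rewrite divr_ge0 ?sqr_ge0.
  apply: ler_pM; rewrite ?nM_le_opnorm ?nM_ge0 //; first by rewrite mulr_ge0.
  by rewrite ler_wpM2l ?nM_le_opnorm.
- have : Num.min (k ^+ 2 / 4) (1 / 2) * nM a <= 1 / 2 * nM a by rewrite ler_wpM2r // ge_min lexx orbT.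
  lra.
- have : Num.min (k ^+ 2 / 4) (1 / 2) * nM b <= 1 / 2 * nM b by rewrite ler_wpM2r // ge_min lexx orbT.
  lra.
- have : Num.min (k ^+ 2 / 4) (1 / 2) <= 1 / 2 by rewrite ge_min lexx orbT.
  lra.
Qed.

(** The transpose satisfies the same relation, so [a] multiplies every squared norm by [d], while it
    multiplies that of [v] by [l ^+ 2]. *)
Lemma similarity_eigenvalue a (d l : R) v : a *m a^T = d%:M -> 0 < d ->
  v != 0 -> a *m v = l *: v -> l ^+ 2 = d.
Proof.
move=> E d0 v0 av.
have E' : a^T *m a = d%:M.
  have : a *m (d^-1 *: a^T) = 1%:M by rewrite -scalemxAr E scale_scalar_mx mulVf ?gt_eqF.
  move=> /mulmx1C; rewrite -scalemxAl => /(congr1 (fun X => d *: X)).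
  by rewrite scalerA divff ?gt_eqF // scale1r scale_scalar_mx mulr1.
move: v0; rewrite -nV_gt0 => v0; apply: (mulIf (lt0r_neq0 v0)); rewrite -nVZ -av.
move: a v E' {E av v0}; apply: mat_elim => x y z t; apply: vec_elim => p q.
rewrite !coordE !nV_mkv => /M4_inj[E1 E2 E3 E4].
transitivity ((x * x + z * z) * p ^+ 2 + (y * y + t * t) * q ^+ 2 + 2 * (x * y + z * t) * p * q).
  by ring.
by rewrite E1 E2 E4; ring.
Qed.

(** After conjugation by [M] each generator is a similarity whose squared ratio is the absolute
    determinant. This passes to products, so all real eigenvalues of a semigroup element have the
    same modulus. *)
Lemma strongly_conformal_not_proximal A : (forall a, A a -> a \in unitmx) ->
  strongly_conformal A -> ~ exists2 a, semigroup A a & proximal a.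
Proof.
move=> hA [M uM H] [a Sa [l1 [l2 [v1 [v2 [[v10 E1] [v20 E2] ne]]]]]].
have K1 b : A b -> (M *m b *m invmx M) *m (M *m b *m invmx M)^T = `|\det b|%:M.
  move=> Ab; have d0 : 0 < `|\det b| by rewrite normr_gt0 -unitmx_det hA.
  have := H _ Ab; rewrite /= linearZ /= -scalemxAl -scalemxAr scalerA.
  rewrite -expr2 exprVn sqr_sqrtr ?ltW // => /(congr1 (fun X => `|\det b| *: X)).
  by rewrite scalerA divff ?gt_eqF // scale1r scale_scalar_mx mulr1.
have K b : semigroup A b -> 
    (M *m b *m invmx M) *m (M *m b *m invmx M)^T = `|\det b|%:M.
  elim=> {b} [b /K1 //|b c /K1 Hb Sc IH].
  have -> : M *m (b *m c) *m invmx M = (M *m b *m invmx M) *m (M *m c *m invmx M).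
    by rewrite !mulmxA mulmxKV.
  rewrite trmx_mul -mulmxA (mulmxA _ (M *m c *m invmx M)^T) IH.
  by rewrite -scalar_mxC mulmxA Hb det_mulmx normrM -scalar_mxM.
have d0 : 0 < `|\det a| by rewrite normr_gt0 -unitmx_det (sg_unitmx hA).
have L l v : v != 0 -> a *m v = l *: v -> l ^+ 2 = `|\det a|.
  move=> v0 E; apply: (similarity_eigenvalue (K _ Sa) d0 (v := M *m v)).
    exact: unitmx_neq0.
  by rewrite mulmxA mulmxKV // -mulmxA E scalemxAr.
case/eqP: ne; apply/eqP; rewrite -(@eqrXn2 _ 2%N) ?normr_ge0 // !real_normK ?num_real //.
by rewrite (L _ _ v10 E1) (L _ _ v20 E2).
Qed.

Lemma mul_sub_scalar a (l : R) v : (a - l%:M) *m v = a *m v - l *: v.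
Proof. by rewrite mulmxBl mul_scalar_mx. Qed.

Lemma mulmxv_eq0 a : (forall v, a *m v = 0) -> a = 0.
Proof.
move=> H; have := H (mkv 1 0); have := H (mkv 0 1); move: a {H}; apply: mat_elim => x y z t.
rewrite !coordE !mulr0 !mulr1 !add0r !addr0 => /mkv_inj[-> ->] /mkv_inj[-> ->] //.
Qed.

(** With [n = a - l], every [n y] is [crs v y] times one vector [w], so [w] is an eigenvector of
    [a]. The only eigenspace is that of [v], hence [crs v w = 0] and [n] kills its own image. *)
Lemma parabolic_nilpotent a : parabolic a ->
  exists l (n : 'M[R]_2), [/\ a = l%:M + n, n != 0 & n *m n = 0].
Proof.
move=> [v [[l [v0 av]] H]]; exists l, (a - l%:M).
have Bv : (a - l%:M) *m v = 0 by rewrite mul_sub_scalar av subrr.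
have [w Hw] := sing_kernel v0 Bv.
have n0 : a - l%:M != 0.
  apply/eqP => B0.
  have [|c E] := H l (orth v).
    split; last by apply/eqP; rewrite -subr_eq0 -mul_sub_scalar B0 mul0mx.
    by move: v0; rewrite -!nV_gt0 nV_mkv sqrrN addrC.
  have := crsZr c v v; rewrite -E crsvv mulr0 => /eqP.
  have -> : crs v (orth v) = nV v by rewrite /crs /orth /nV !coordE; ring.
  by rewrite nV_eq0 (negPf v0).
split=> //; first by rewrite addrC subrK.
have w0 : w != 0.
  by apply: contraNN n0 => /eqP w0; apply/eqP/mulmxv_eq0 => y; rewrite Hw w0 scaler0.
have [|c wE] := H (l + crs v w) w.
  by split=> //; apply/eqP; rewrite -subr_eq0 scalerDl opprD addrA -mul_sub_scalar Hw subrr.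
apply: mulmxv_eq0 => y; rewrite -mulmxA !Hw crsZr.
by have -> : crs v w = 0; rewrite ?mulr0 ?scale0r // wE crsZr crsvv mulr0.
Qed.

(** Apart from powers of [l], the squared norm of the m-th power of [a] grows like m^2. The norm
    inequality applied to the square of such a power would require growth m^4. *)
Lemma sg_no_parabolic (A : set 'M[R]_2) (k : R) : 0 < k ->
  (forall a, A a -> a \in unitmx) ->
  (forall a b, semigroup A a -> semigroup A b -> k * nM a * nM b <= nM (a *m b)) ->
  ~ exists2 a, semigroup A a & parabolic a.
Proof.
move=> k0 hA H [a Sa /parabolic_nilpotent [l [n [aE n0 nn]]]].
have l0 : l != 0.
  apply/eqP => l0; have : (a *m a) \in unitmx by apply: (sg_unitmx hA); exact: sg_mulmx.
  rewrite aE l0 raddf0 add0r nn unitmx_det => /negP; apply; apply/eqP.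
  by rewrite det0.
(* [X m] is the power of [a] with exponent [m.+1]; this shift explains the successor in [XM]. *)
pose X (m : nat) := l ^+ m *: (l%:M + m.+1%:R *: n).
have XM i j : X i *m X j = X (i + j).+1.
  rewrite /X -scalemxAl -scalemxAr scalerA -exprD mulmxDl !mulmxDr.
  rewrite -!scalemxAl -!scalemxAr nn !scaler0 addr0 !mul_scalar_mx scalar_mxC mul_scalar_mx.
  rewrite scale_scalar_mx -addrA !scalerA -scalerDl -mulrDl -natrD addSn addnS addnC.
  rewrite exprSr -[RHS]scalerA [l *: (_ + _)]scalerDr scale_scalar_mx [l *: (_ *: n)]scalerA; congr (_ *: (_ + _ *: _)).
  by rewrite mulrC.
have SX m : semigroup A (X m).
  elim: m => [|m IH]; first by rewrite /X expr0 !scale1r -aE.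
  by have := sg_mulmx Sa IH; rewrite [a]aE -[n in _ + n]scale1r -[l%:M + _]scale1r -(expr0 l) XM.
have nu0 : 0 < nM n by rewrite nM_gt0.
set nu := nM n in nu0.
have L0 : 0 < l ^+ 2 by rewrite exprn_even_gt0.
set L := l ^+ 2 in L0.
have gle (x : R) : nM (l%:M + x *: n) <= 4 * L + 2 * (x ^+ 2 * nu).
  rewrite /L /nu; move: (n); apply: mat_elim => p q r s; rewrite !coordE !nM_M4 !add0r !exprMn.
  have := sqr_ge0 (l - x * p); have := sqr_ge0 (l - x * s).
  have := sqr_ge0 (x * q); have := sqr_ge0 (x * r); lra.
have gge (x : R) : x ^+ 2 * nu / 2 - 2 * L <= nM (l%:M + x *: n).
  rewrite /L /nu; move: (n); apply: mat_elim => p q r s; rewrite !coordE !nM_M4 !add0r !exprMn.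
  have := sqr_ge0 (2 * l + x * p); have := sqr_ge0 (2 * l + x * s).
  have := sqr_ge0 (x * q); have := sqr_ge0 (x * r); lra.
have key m : k * nM (l%:M + m.+1%:R *: n) ^+ 2 <= L * nM (l%:M + (m + m).+2%:R *: n).
  have h := H _ _ (SX m) (SX m); rewrite XM /X !nMZ in h.
  have e : l ^+ (m + m).+1 = l * (l ^+ m * l ^+ m) by rewrite exprS exprD.
  have lm : 0 < (l ^+ m) ^+ 2 * (l ^+ m) ^+ 2.
    by rewrite mulr_gt0 // exprn_even_gt0 //= expf_neq0.
  by rewrite -(ler_pM2l lm); apply: etrans h; congr (_ <= _); rewrite ?e /L; ring.
have Lk : 0 < 144 * L / k by rewrite divr_gt0 // mulr_gt0.
have c0 : 0 < 8 * L + 144 * L / k by lra.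
(* With z = M^2 nu, the bound 8 L < z makes the lower estimate [gge] at least z / 4, and 144 L < k z
   makes k (z / 4)^2 exceed 9 L z, which dominates L (4 L + 8 z). *)
have [m Hm] : exists m : nat, 8 * L + 144 * L / k < m.+1%:R * nu.
  exists (Num.bound ((8 * L + 144 * L / k) / nu)); rewrite -ltr_pdivrMr //.
  apply: lt_le_trans (archi_boundP _) _; last by rewrite ler_nat.
  by rewrite ltW // divr_gt0.
set M : R := m.+1%:R in Hm.
have M1 : 1 <= M by rewrite ler1n.
set z := M ^+ 2 * nu.
have zM : M * nu <= z by rewrite /z expr2 -mulrA ler_peMl // mulr_ge0 ?ltW // (lt_le_trans ltr01).
have z8 : 8 * L < z by lra.
have z144 : 144 * L < z * k by rewrite -ltr_pdivrMr //; lra.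
have := key m; apply/negP; rewrite -ltNge.
have -> : (m + m).+2%:R = 2 * M :> R by rewrite /M -natrM mul2n -addnn addSn addnS.
apply: (@le_lt_trans _ _ (L * (4 * L + 8 * z))).
  by rewrite ler_pM2l //; apply: le_trans (gle _) _; rewrite /z; lra.
apply: (@lt_le_trans _ _ (k * (z / 4) ^+ 2)); last first.
  rewrite ler_pM2l // lerXn2r ?nnegrE ?nM_ge0 //; first by lra.
  by apply: le_trans (gge _); rewrite -/M -/z; lra.
have h1 : 144 * L * z < z * k * z by rewrite ltr_pM2r //; lra.
have h2 : 4 * L * L <= L * z / 2 by have := ler_wpM2l (ltW L0) (ltW z8); lra.
have h3 : 0 < L * z by rewrite mulr_gt0 //; lra.
lra.
Qed.

End Semigroup.

(** * Continuity and compactness for matrices *)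

Section Topology.
Variable R : realType.
Set Implicit Arguments. Unset Strict Implicit.
Implicit Types (A : set 'M[R]_2) (a b P Q : 'M[R]_2) (u v w : 'cV[R]_2).

(** A neighbourhood of a matrix contains a box given by finitely many neighbourhoods of its
    entries. *)
Lemma cvg_mx (T : Type) (F : set_system T) {FF : Filter F} m n (f : T -> 'M[R]_(m, n)) (X : 'M[R]_(m, n)) :
  (forall i j, f t i j @[t --> F] --> X i j) -> f @ F --> X.
Proof.
move=> H B [P HP HB]; apply: (@filterS _ F _ (fun t => forall i j, P i j (f t i j))).
  by move=> t Ht; apply: HB.
apply: filter_forall => i; apply: filter_forall => j.
exact: H (HP i j).
Qed.

Lemma cvg_M4 (T : Type) (F : set_system T) {FF : Filter F} (f1 f2 f3 f4 : T -> R) (a b c d : R) :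
  f1 @ F --> a -> f2 @ F --> b -> f3 @ F --> c -> f4 @ F --> d ->
  (fun t => M4 (f1 t) (f2 t) (f3 t) (f4 t)) @ F --> M4 a b c d.
Proof.
move=> H1 H2 H3 H4; apply: cvg_mx => i j; rewrite mxE; under eq_cvg do rewrite mxE.
by case: (I2P i) => ->; case: (I2P j) => ->.
Qed.

Lemma cvg_mkv (T : Type) (F : set_system T) {FF : Filter F} (f1 f2 : T -> R) (a b : R) :
  f1 @ F --> a -> f2 @ F --> b -> (fun t => mkv (f1 t) (f2 t)) @ F --> mkv a b.
Proof.
move=> H1 H2; apply: cvg_mx => i j; rewrite mxE; under eq_cvg do rewrite mxE.
by case: (I2P i) => ->.
Qed.

Lemma cvg_entry (T : Type) (F : set_system T) {FF : Filter F} m n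
   (f : T -> 'M[R]_(m, n)) (X : 'M[R]_(m, n)) i j : f @ F --> X -> f t i j @[t --> F] --> X i j.
Proof. by move=> fX; apply: (cvg_comp f (fun M : 'M[R]_(m, n) => M i j) fX); exact: coord_continuous. Qed.

Lemma cvg_mulmx (T : Type) (F : set_system T) {FF : Filter F} m p
   (f : T -> 'M[R]_(m, 2)) (g : T -> 'M[R]_(2, p)) (X : 'M[R]_(m, 2)) (Y : 'M[R]_(2, p)) :
  f @ F --> X -> g @ F --> Y -> (fun t => f t *m g t) @ F --> X *m Y.
Proof.
move=> fX gY; apply: cvg_mx => i j; rewrite mxE !big_ord_recl big_ord0 addr0.
under eq_cvg do rewrite mxE !big_ord_recl big_ord0 addr0.
by apply: cvgD; apply: cvgM; apply: cvg_entry.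
Qed.

Lemma cvg_nM (T : Type) (F : set_system T) {FF : Filter F} (f : T -> 'M[R]_2) (X : 'M[R]_2) :
  f @ F --> X -> nM (f t) @[t --> F] --> nM X.
Proof.
move=> fX; rewrite /nM !expr2; under eq_cvg do rewrite /nM !expr2.
by do ![apply: cvgD | apply: cvgM]; apply: cvg_entry.
Qed.

Lemma cvg_det (T : Type) (F : set_system T) {FF : Filter F} (f : T -> 'M[R]_2) (X : 'M[R]_2) :
  f @ F --> X -> \det (f t) @[t --> F] --> \det X.
Proof.
move=> fX; rewrite (M4E X) detM4; under eq_cvg do rewrite (M4E (f _)) detM4.
by do ![apply: cvgB | apply: cvgM]; apply: cvg_entry.
Qed.

Lemma cvg_nV (T : Type) (F : set_system T) {FF : Filter F} (f : T -> 'cV[R]_2) (X : 'cV[R]_2) :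
  f @ F --> X -> nV (f t) @[t --> F] --> nV X.
Proof.
move=> fX; rewrite /nV !expr2; under eq_cvg do rewrite /nV !expr2.
by do ![apply: cvgD | apply: cvgM]; apply: cvg_entry.
Qed.

Lemma cvg_crs (T : Type) (F : set_system T) {FF : Filter F} (f g : T -> 'cV[R]_2) (X Y : 'cV[R]_2) :
  f @ F --> X -> g @ F --> Y -> crs (f t) (g t) @[t --> F] --> crs X Y.
Proof.
by move=> fX gY; apply: cvgB; apply: cvgM; apply: cvg_entry.
Qed.

Lemma cvg_outer (T : Type) (F : set_system T) {FF : Filter F} (f g : T -> 'cV[R]_2) (X Y : 'cV[R]_2) :
  f @ F --> X -> g @ F --> Y -> outer (f t) (g t) @[t --> F] --> outer X Y.
Proof.
by move=> fX gY; apply: cvg_M4; apply: cvgM; apply: cvg_entry.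
Qed.

Lemma cvg_line (T : Type) (F : set_system T) {FF : Filter F} (f : T -> 'cV[R]_2) (X : 'cV[R]_2) :
  X != 0 -> f @ F --> X -> line (f t) @[t --> F] --> line X.
Proof.
rewrite -nV_gt0 => X0 fX.
have xX : vx (f t) @[t --> F] --> vx X by exact: cvg_entry.
have yX : vy (f t) @[t --> F] --> vy X by exact: cvg_entry.
have nX : nV (f t) @[t --> F] --> nV X by exact: cvg_nV.
have iX : (nV (f t))^-1 @[t --> F] --> (nV X)^-1.
  exact: (@cvgV _ _ F _ (fun t => nV (f t)) _ (lt0r_neq0 X0) nX).
have pX : (line (f t)).1 @[t --> F] --> (line X).1.
  apply: cvgM => //; rewrite !expr2; under eq_cvg do rewrite !expr2.
  by apply: cvgB; apply: cvgM.
have qX : (line (f t)).2 @[t --> F] --> (line X).2.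
  by apply: cvgM => //; do 2?[apply: cvgM => //]; exact: cvg_cst.
rewrite (surjective_pairing (line X)); under eq_cvg do rewrite (surjective_pairing (line _)).
exact: (cvg_pair pX qX).
Qed.

Lemma mulmx_continuous_r P : continuous (fun X : 'M[R]_2 => P *m X).
Proof. by move=> X; apply: (@cvg_mulmx _ (nbhs X)); [exact: cvg_cst | exact: cvg_id]. Qed.

Lemma mulmx_continuous_l P : continuous (fun X : 'M[R]_2 => X *m P).
Proof. by move=> X; apply: (@cvg_mulmx _ (nbhs X)); [exact: cvg_id | exact: cvg_cst]. Qed.

Lemma nM_continuous : continuous (@nM R).
Proof. by move=> X; apply: (@cvg_nM _ (nbhs X)); exact: cvg_id. Qed.

Lemma det_continuous : continuous (fun X : 'M[R]_2 => \det X).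
Proof. by move=> X; apply: (@cvg_det _ (nbhs X)); exact: cvg_id. Qed.

(** The entries lie in [-1, 1], so [K] is a closed subset of a continuous image of a compact
    cube. *)
Lemma compact_mat (K : set 'M[R]_2) : closed K -> (forall P, K P -> nM P <= 1) -> compact K.
Proof.
move=> cK K1; pose I := `[-1, 1 : R]%classic.
pose f (t : R * R * (R * R)) := M4 t.1.1 t.1.2 t.2.1 t.2.2.
apply: (@subclosed_compact _ K (f @` ((I `*` I) `*` (I `*` I)))) => //.
  apply: continuous_compact; last by do !apply: compact_setX; exact: segment_compact.
  apply: continuous_subspaceT => t; apply: cvg_M4.
  - by apply: cvg_comp (cvg_fst) _; exact: cvg_fst.
  - by apply: cvg_comp (cvg_fst) _; exact: cvg_snd.
  - by apply: cvg_comp (cvg_snd) _; exact: cvg_fst.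
  - by apply: cvg_comp (cvg_snd) _; exact: cvg_snd.
move=> P /K1; rewrite /nM => h.
have H i j : I (P i j).
  rewrite /I /= in_itv /= -ler_norml -(@expr_le1 _ 2%N) // real_normK ?num_real //.
  have := sqr_ge0 (P ord0 ord0); have := sqr_ge0 (P ord0 (lift ord0 ord0)).
  have := sqr_ge0 (P (lift ord0 ord0) ord0); have := sqr_ge0 (P (lift ord0 ord0) (lift ord0 ord0)).
  by case: (I2P i) => ->; case: (I2P j) => ->; lra.
exists ((P ord0 ord0, P ord0 (lift ord0 ord0)), (P (lift ord0 ord0) ord0, P (lift ord0 ord0) (lift ord0 ord0))); first by split; split; exact: H.
by rewrite /f /= -M4E.
Qed.

Lemma compact_vec (K : set 'cV[R]_2) : closed K -> (forall v, K v -> nV v <= 1) -> compact K.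
Proof.
move=> cK K1; pose I := `[-1, 1 : R]%classic.
pose f (t : R * R) := mkv t.1 t.2.
apply: (@subclosed_compact _ K (f @` (I `*` I))) => //.
  apply: continuous_compact; last by do !apply: compact_setX; exact: segment_compact.
  by apply: continuous_subspaceT => t; apply: cvg_mkv; [exact: cvg_fst | exact: cvg_snd].
move=> v /K1; rewrite /nV => h; exists (vx v, vy v); last by rewrite /f /= -mkvE.
by split; rewrite /I /= in_itv /= -ler_norml -(@expr_le1 _ 2%N) // real_normK ?num_real //;
  have := sqr_ge0 (vx v); have := sqr_ge0 (vy v); lra.
Qed.

End Topology.

(** * The closed cone of the semigroup *)

Section Closure.
Variable R : realType.
Set Implicit Arguments. Unset Strict Implicit.

Lemma closure_map (T U : topologicalType) (f : T -> U) (X : set T) (Y : set U) x :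
  f @ x --> f x -> (forall y, X y -> Y (f y)) -> closure X x -> closure Y (f x).
Proof.
by move=> cf XY cX B /cf /cX [y [Xy By]]; exists (f y); split=> //; exact: XY.
Qed.

Lemma closure_le_fun (T : topologicalType) (f g : T -> R) (X : set T) x :
  f @ x --> f x -> g @ x --> g x -> (forall y, X y -> f y <= g y) ->
  closure X x -> f x <= g x.
Proof.
move=> cf cg H cX; rewrite -subr_ge0.
have : closure [set y : R | 0 <= y] (g x - f x).
  by apply: (@closure_map _ _ (fun t => g t - f t) X) cX => [|y /H]; [exact: cvgB|rewrite /= subr_ge0].
by move/closure_id: (@closed_ge R 0) => <-.
Qed.

Lemma closed_le_fun (T : topologicalType) (f g : T -> R) :
  (forall x, f @ x --> f x) -> (forall x, g @ x --> g x) -> closed [set x | f x <= g x].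
Proof. by move=> cf cg x; apply: closure_le_fun. Qed.

Lemma closed_preimage (T U : topologicalType) (f : T -> U) (Y : set U) :
  (forall x, f @ x --> f x) -> closed Y -> closed [set x | Y (f x)].
Proof. by move=> cf cY x cX; apply: cY; apply: closure_map cX. Qed.

Lemma char_root_eigenvector (X : 'M[R]_2) (l : R) : \det (X - l%:M) = 0 ->
  exists2 w : 'cV[R]_2, w != 0 & X *m w = l *: w.
Proof.
have E (w : 'cV[R]_2) : (X - l%:M) *m w = 0 -> X *m w = l *: w.
  by rewrite mul_sub_scalar => /eqP; rewrite subr_eq0 => /eqP.
have [B0 _|B0 /(det0_outer B0)[u [p [_ p0 B]]]] := eqVneq (X - l%:M) 0.
  by exists (mkv 1 0); [rewrite -nV_gt0 nV_mkv expr0n addr0 expr1n | apply: E; rewrite B0 mul0mx].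
exists (orth p); first by move: p0; rewrite -!nV_gt0 nV_mkv sqrrN addrC.
have d0 : dot p (orth p) = 0 by rewrite /dot /orth vx_mkv vy_mkv; ring.
by apply: E; rewrite B outer_mulv d0 scale0r.
Qed.

Variables (A : set 'M[R]_2) (k : R).
Hypothesis k0 : 0 < k <= 1 / 2.
Hypothesis Ak : forall a b, sg1 A a -> sg1 A b -> k * nM a * nM b <= nM (a *m b).
Implicit Types (a b P Q X : 'M[R]_2) (u v w s p : 'cV[R]_2).

Definition cone : set 'M[R]_2 := [set X | exists c a, sg1 A a /\ X = c *: a].
Definition ccone : set 'M[R]_2 := closure cone.

Lemma cone_mul P Q : cone P -> cone Q -> cone (P *m Q).
Proof.
move=> [c [a [Sa ->]]] [d [b [Sb ->]]]; exists (c * d), (a *m b).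
by split; [exact: sg1_mulmx | rewrite -scalemxAl -scalemxAr scalerA].
Qed.

Lemma cone_scale (c : R) P : cone P -> cone (c *: P).
Proof. by move=> [d [a [Sa ->]]]; exists (c * d), a; rewrite scalerA. Qed.

Lemma cone_nM P Q : cone P -> cone Q -> k * nM P * nM Q <= nM (P *m Q).
Proof.
move=> [c [a [Sa ->]]] [d [b [Sb ->]]].
rewrite -scalemxAl -scalemxAr !nMZ.
have h : 0 <= c ^+ 2 * d ^+ 2 by rewrite mulr_ge0 ?sqr_ge0.
by apply: etrans (ler_wpM2l h (Ak Sa Sb)); congr (_ <= _); ring.
Qed.

Lemma cone1 : cone 1%:M.
Proof. by exists 1, 1%:M; rewrite scale1r; split=> //; right. Qed.

Lemma cone_sg a : semigroup A a -> cone a.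
Proof. by exists 1, a; rewrite scale1r; split=> //; left. Qed.

Lemma cone_ccone P : cone P -> ccone P. Proof. exact: subset_closure. Qed.

Lemma closed_ccone : closed ccone. Proof. exact: closed_closure. Qed.

Lemma ccone_scale (c : R) P : ccone P -> ccone (c *: P).
Proof.
apply: (closure_map (f := fun X => c *: X)) => [|X]; last exact: cone_scale.
exact: scaler_continuous.
Qed.

(** The limit is taken in one factor at a time, by continuity of left and then right multiplication;
    [ccone_nM] proceeds in the same way. *)
Lemma ccone_mul P Q : ccone P -> ccone Q -> ccone (P *m Q).
Proof.
move=> GP GQ; apply: closed_ccone.
apply: (closure_map (f := fun X => P *m X) (X := cone)) GQ => [|X cX].
  exact: mulmx_continuous_r.
apply: (@closure_map _ _ (fun Y : 'M[R]_2 => Y *m X) cone cone P _ _ GP) => [|Y cY].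
  exact: mulmx_continuous_l.
exact: cone_mul.
Qed.

Lemma ccone_nM P Q : ccone P -> ccone Q -> k * nM P * nM Q <= nM (P *m Q).
Proof.
move=> GP GQ.
apply: (closure_le_fun (f := fun X => k * nM P * nM X) (g := fun X => nM (P *m X)) (X := cone)) GQ
  => [||X cX].
- by apply: (@cvgM _ _ (nbhs Q)); [exact: cvg_cst | exact: nM_continuous].
- by apply: (@cvg_nM _ _ (nbhs Q)); exact: mulmx_continuous_r.
apply: (closure_le_fun (f := fun Y => k * nM Y * nM X) (g := fun Y => nM (Y *m X)) (X := cone)) GP
  => [||Y cY].
- apply: (@cvgM _ _ (nbhs P)); last exact: cvg_cst.
  by apply: (@cvgM _ _ (nbhs P)); [exact: cvg_cst | exact: nM_continuous].
- by apply: (@cvg_nM _ _ (nbhs P)); exact: mulmx_continuous_l.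
exact: cone_nM.
Qed.

Lemma ccone_proximal a l l' u s : semigroup A a ->
  a *m u = l *: u -> a *m s = l' *: s -> `|l'| < `|l| -> ccone (outer u (orth s)).
Proof.
move=> Sa au as_ ll; have l0 : l != 0 by rewrite -normr_gt0 (le_lt_trans _ ll).
pose r := l' / l.
have r1 : `|r| < 1 by rewrite normrM normfV ltr_pdivrMr ?normr_gt0 // mul1r.
(* In the eigenbasis, a^m is (l^m / crs s u) X m, so X m is in the cone and tends
   to the rank-one matrix with image u and kernel s. *)
pose X m := outer u (orth s) - r ^+ m *: outer s (orth u).
have cX m : cone (X m).
  elim: m => [|m IH].
    (* Cramer's expansion in the pair [u], [s]: crs s v * u - crs u v * s = crs s u * v. *)
    have -> : X 0%N = crs s u *: 1%:M.
      rewrite /X expr0 scale1r; move: (u) (s); apply: vec_elim => ? ?; apply: vec_elim => ? ?.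
      by rewrite /outer /crs /orth !coordE; congr M4; ring.
    exact/cone_scale/cone1.
  have -> : X m.+1 = l^-1 *: (a *m X m).
    rewrite /X mulmxBr -scalemxAr !mul_outer au as_ !outerZ scalerBr !scalerA mulVf // scale1r.
    by congr (_ - _ *: _); rewrite exprSr /r; ring.
  by apply/cone_scale/cone_mul => //; exact: cone_sg.
have lX : X @ \oo --> outer u (orth s).
  rewrite -[X in _ --> X]subr0 -(scale0r (outer s (orth u))).
  apply: cvgB; first exact: cvg_cst.
  by apply: cvgZr_tmp; exact: cvg_expr.
by move=> B /lX [m _ Hm]; exists (X m); split=> //; apply: Hm => /=.
Qed.

(** The product of [outer w (orth s)], [P] and [outer u p] is [crs s (P *m u)] times [outer w p].
    Applying the norm inequality to both multiplications gives the factor [k ^+ 2]. *)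
Lemma outer_transversality P u p w s : ccone P -> ccone (outer u p) -> p != 0 ->
  ccone (outer w (orth s)) -> w != 0 ->
  k ^+ 2 * nV s * nM P * nV u <= crs s (P *m u) ^+ 2.
Proof.
have /andP[kp kh] := k0; rewrite -!nV_gt0 => GP Gu p0 Gs w0.
have h1 := ccone_nM Gs (ccone_mul GP Gu).
have h2 := ccone_nM GP Gu.
have os : nV (orth s) = nV s by rewrite nV_mkv sqrrN addrC.
have dE : dot (orth s) (P *m u) = crs s (P *m u) by rewrite /dot /crs /orth !coordE; ring.
have E : outer w (orth s) *m (P *m outer u p) = outer (crs s (P *m u) *: w) p.
  by rewrite mul_outer mul_outer outer_mulv dE.
rewrite E !nM_outer nVZ os in h1; rewrite nM_outer in h2.
have kw : 0 <= k * (nV w * nV s) by rewrite !mulr_ge0 ?nV_ge0 //; lra.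
have h3 := le_trans (ler_wpM2l kw h2) h1.
have wp : 0 < nV w * nV p by rewrite mulr_gt0.
rewrite -(ler_pM2l wp).
by apply: etrans h3; congr (_ <= _); ring.
Qed.

(** Decompose [v] along [u] and [orth u]. The first part is controlled by [outer_transversality];
    the second is an error proportional to [crs u v]. The threshold [k ^+ 2 / 8] and k <= 1/2 make
    that error small enough to keep a quarter of [k ^+ 2]. *)
Lemma outer_cone_transversality P u p w s v : ccone P -> ccone (outer u p) -> p != 0 -> u != 0 ->
  ccone (outer w (orth s)) -> w != 0 -> crs u v ^+ 2 <= k ^+ 2 / 8 * (nV u * nV v) ->
  k ^+ 2 / 4 * (nV s * nM P * nV v) <= crs s (P *m v) ^+ 2.
Proof.
have /andP[kp kh] := k0; move=> GP Gu p0 u0 Gs w0 cuv.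
have h := outer_transversality GP Gu p0 Gs w0.
have h2 : crs s (P *m orth u) ^+ 2 <= nV s * nM P * nV u.
  apply: (@le_trans _ _ (nV s * nV (P *m orth u))).
    move: (P *m orth u) => z; rewrite /crs /nV.
    have := sqr_ge0 (vx s * vx z + vy s * vy z); lra.
  rewrite -mulrA ler_wpM2l ?nV_ge0 //; apply: le_trans (nV_mul _ _) _.
  by rewrite nV_mkv sqrrN addrC.
have dec : nV u * crs s (P *m v) = dot u v * crs s (P *m u) + crs u v * crs s (P *m orth u).
  move: (u) (v) (P) (s); apply: vec_elim => ? ?; apply: vec_elim => ? ?.
  apply: mat_elim => ? ? ? ?; apply: vec_elim => ? ?.
  by rewrite /nV /crs /dot /orth !coordE; ring.
have pyth : dot u v ^+ 2 + crs u v ^+ 2 = nV u * nV v by rewrite /dot /crs /nV; ring.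
have u1 : 0 < nV u by rewrite nV_gt0.
rewrite -(ler_pM2l (mulr_gt0 u1 u1)).
have -> : nV u * nV u * crs s (P *m v) ^+ 2 = (nV u * crs s (P *m v)) ^+ 2 by ring.
rewrite dec.
set x := dot u v in pyth *; set y := crs u v in pyth cuv *.
set f := crs s (P *m u) in h *; set g := crs s (P *m orth u) in h2 *.
set T := nV s * nM P * nV u.
have T0 : 0 <= T by rewrite !mulr_ge0 ?nV_ge0 ?nM_ge0.
(* A sum is bounded below by half the square of its main term minus the square of the error. *)
have q1 : (x * f) ^+ 2 / 2 - (y * g) ^+ 2 <= (x * f + y * g) ^+ 2.
  have := sqr_ge0 (x * f + 2 * (y * g)); lra.
apply: le_trans q1.
have q2 : x ^+ 2 * (k ^+ 2 * T) <= (x * f) ^+ 2.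
  rewrite exprMn ler_wpM2l ?sqr_ge0 //; apply: le_trans h; rewrite /T le_eqVlt; apply/orP; left; apply/eqP; ring.
have q3 : (y * g) ^+ 2 <= y ^+ 2 * T by rewrite exprMn ler_wpM2l ?sqr_ge0.
set N := nV u * nV v in cuv pyth.
have N0 : 0 <= N by rewrite mulr_ge0 ?nV_ge0.
have k2 : k ^+ 2 <= 1 / 4.
  have -> : 1 / 4 = (1 / 2) ^+ 2 :> R by field.
  by rewrite lerXn2r ?nnegrE //; lra.
have q4 : y ^+ 2 * T <= k ^+ 2 / 8 * N * T by rewrite ler_wpM2r.
have q5 : x ^+ 2 = N - y ^+ 2 by rewrite -pyth; ring.
have NT : 0 <= N * T by exact: mulr_ge0.
have K0 := sqr_ge0 k.
have q6 : k ^+ 2 * (N * T) <= 1 / 4 * (N * T) by apply: ler_wpM2r.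
have q7 : k ^+ 2 * (k ^+ 2 / 8 * N * T) <= 1 / 4 * (k ^+ 2 / 8 * N * T).
  by apply: ler_wpM2r => //; rewrite mulr_ge0 // mulr_ge0 // divr_ge0.
have q8 : k ^+ 2 * (y ^+ 2 * T) <= k ^+ 2 * (k ^+ 2 / 8 * N * T) by rewrite ler_wpM2l.
have -> : nV u * nV u * (k ^+ 2 / 4 * (nV s * nM P * nV v)) = k ^+ 2 / 4 * (N * T) by rewrite /N /T; ring.
have q9 : 0 <= k ^+ 2 * (N * T) by exact: mulr_ge0.
move: q2; rewrite q5 => q2.
lra.
Qed.

End Closure.

(** * Rank-one limits and unstable directions *)

Section Perturbation.
Variable R : realType.
Set Implicit Arguments. Unset Strict Implicit.
Variables (A : set 'M[R]_2) (k : R).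
Hypothesis k0 : 0 < k <= 1 / 2.
Hypothesis Ak : forall a b, sg1 A a -> sg1 A b -> k * nM a * nM b <= nM (a *m b).
Implicit Types (a b P Q X : 'M[R]_2) (u v w s p : 'cV[R]_2).

Definition tr2 X : R := X ord0 ord0 + X (lift ord0 ord0) (lift ord0 ord0).
Definition disc X : R := tr2 X ^+ 2 - 4 * \det X.
(** The smaller characteristic root when [disc X] is nonnegative; the other is
    [tr2 X - small_root X]. Since [Num.sqrt] is 0 on negative numbers, the formula is continuous
    everywhere. *)
Definition small_root X : R := (tr2 X - Num.sqrt (disc X)) / 2.

Lemma cvg_small_root (T : Type) (F : set_system T) {FF : Filter F}
    (f : T -> 'M[R]_2) (X : 'M[R]_2) :
  f @ F --> X ->
  [/\ tr2 (f t) @[t --> F] --> tr2 X, disc (f t) @[t --> F] --> disc X &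
      small_root (f t) @[t --> F] --> small_root X].
Proof.
move=> fX.
have ct : tr2 (f t) @[t --> F] --> tr2 X by apply: cvgD; exact: cvg_entry.
have cd : disc (f t) @[t --> F] --> disc X.
  rewrite /disc expr2; under eq_cvg do rewrite /disc expr2.
  apply: cvgB; first exact: cvgM.
  by apply: cvgM; [exact: cvg_cst | exact: cvg_det].
split=> //; apply: cvgM; last exact: cvg_cst.
apply: cvgB => //; apply: (cvg_comp _ _ cd); exact: sqrt_continuous.
Qed.

Lemma charpoly2 X (l : R) : \det (X - l%:M) = l ^+ 2 - tr2 X * l + \det X.
Proof. by move: X; apply: mat_elim => *; rewrite /tr2 !coordE !mxE /=; ring. Qed.

(** Cayley-Hamilton in factored form: at a characteristic root [l], every nonzero vector in the
    image of [X - l] is an eigenvector for the other root. *)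
Lemma cayley2 X (l : R) : (X - (tr2 X - l)%:M) *m (X - l%:M) = - (\det (X - l%:M))%:M.
Proof.
move: X; apply: mat_elim => *; rewrite /tr2 !mxE /= !coordE.
by congr M4; ring.
Qed.

(** The unstable eigenvector is given by a formula continuous in [X]. Positive trace and
    discriminant make the larger root dominate in absolute value. *)
Lemma proximal_near X v : 0 < tr2 X -> 0 < disc X ->
  (X - (small_root X)%:M) *m v != 0 ->
  exists2 w : 'cV[R]_2, w != 0 & [/\ X *m w = small_root X *: w,
    X *m ((X - (small_root X)%:M) *m v) =
      (tr2 X - small_root X) *: ((X - (small_root X)%:M) *m v) &
    `|small_root X| < `|tr2 X - small_root X| ].
Proof.
move=> t0 d0 v0.
have s0 : 0 < Num.sqrt (disc X) by rewrite sqrtr_gt0.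
have E : \det (X - (small_root X)%:M) = 0.
  rewrite charpoly2 /small_root.
  have := sqr_sqrtr (ltW d0); rewrite {2}/disc; move: (Num.sqrt _) => q h.
  have -> : \det X = (tr2 X ^+ 2 - q ^+ 2) / 4 by rewrite h; field.
  by field.
have [w w0 Xw] := char_root_eigenvector E.
exists w => //; split=> //.
  by apply/eqP; rewrite -subr_eq0 -mul_sub_scalar mulmxA cayley2 E raddf0 oppr0 mul0mx.
rewrite [ltRHS]ger0_norm; first by rewrite ltr_norml /small_root; lra.
by rewrite /small_root; lra.
Qed.

(** A rank-one element of nonzero trace has a simple nonzero eigenvalue with eigenvector [u].
    Elements of the cone close to it are therefore proximal, with unstable direction close to
    [u]. *)
Lemma ccone_near_unstable u p : ccone A (outer u p) -> u != 0 -> p != 0 ->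
  forall W, nbhs (line u) W -> exists a v, [/\ semigroup A a, is_u a v & W (line v)].
Proof.
have /andP[kp kh] := k0.
move=> Gup u0 p0 W HW.
(* Squaring [outer u p] multiplies it by [dot p u], so the norm inequality forbids [dot p u = 0]; a
   change of sign then makes the trace positive. *)
have [q [q0 qu Gq]] : exists q, [/\ q != 0, 0 < dot q u & ccone A (outer u q)].
  have := ccone_nM Ak Gup Gup; rewrite mul_outer outer_mulv outerZ nMZ.
  have n0 : 0 < nM (outer u p) by rewrite nM_outer mulr_gt0 ?nV_gt0.
  rewrite ler_pM2r // => h.
  have d0 : dot p u != 0.
    by rewrite -sqrf_eq0 gt_eqF //; apply: lt_le_trans h; rewrite mulr_gt0.
  have [d1|d1|d1] := ltgtP 0 (dot p u); last by rewrite -d1 eqxx in d0.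
    by exists p.
  exists (- p); split; rewrite ?oppr_eq0 //.
    by rewrite /dot /vx /vy !mxE !mulNr -opprD oppr_gt0.
  have -> : outer u (- p) = -1 *: outer u p; last exact: ccone_scale.
  by rewrite /outer /vx /vy !mxE !coordE; congr M4; ring.
set P := outer u q in Gq.
have tP : tr2 P = dot q u by rewrite /tr2 /P /outer !mxE /= /dot; ring.
have dP : disc P = dot q u ^+ 2 by rewrite /disc tP det_outer mulr0 subr0.
have rP : small_root P = 0 by rewrite /small_root dP tP sqrtr_sqr ger0_norm ?ltW // subrr mul0r.
pose g X := (X - (small_root X)%:M) *m q.
have gP : g P = nV q *: u by rewrite /g rP raddf0 subr0 outer_mulv.
have gP0 : g P != 0 by rewrite gP scaler_eq0 negb_or nV_eq0 q0.
have [ct cd cr] := @cvg_small_root _ (nbhs P) _ id P cvg_id.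
have cg : g X @[X --> nbhs P] --> g P.
  apply: (@cvg_mulmx _ _ (nbhs P)); last exact: cvg_cst.
  apply: (@cvgB _ _ _ (nbhs P)); first exact: cvg_id.
  under eq_cvg do rewrite scalarM4; rewrite scalarM4.
  by apply: (@cvg_M4 _ _ (nbhs P)) => //; exact: cvg_cst.
have cl : line (g X) @[X --> nbhs P] --> line (g P).
  exact: (@cvg_line _ _ (nbhs P) _ g (g P) gP0 cg).
have cn : nV (g X) @[X --> nbhs P] --> nV (g P).
  exact: (@cvg_nV _ _ (nbhs P) _ g (g P) cg).
rewrite gP lineZ ?nV_eq0 // in cl.
have N1 : \forall X \near nbhs P, 0 < tr2 X.
  by apply: (@cvgr_gt _ _ (nbhs P) _ (fun X => tr2 X) _ ct 0); rewrite tP.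
have N2 : \forall X \near nbhs P, 0 < disc X.
  by apply: (@cvgr_gt _ _ (nbhs P) _ (fun X => disc X) _ cd 0); rewrite dP exprn_gt0.
have N3 : \forall X \near nbhs P, 0 < nV (g X).
  by apply: (@cvgr_gt _ _ (nbhs P) _ (fun X => nV (g X)) _ cn 0); rewrite nV_gt0.
have N4 : \forall X \near nbhs P, W (line (g X)) by exact: cl.
have [X [[c [a [Sa XE]]] [[[h1 h2] h3] h4]]] := Gq _ (filterI (filterI (filterI N1 N2) N3) N4).
rewrite nV_gt0 in h3.
have [w w0 [Xw Xg rr]] := proximal_near h1 h2 h3.
have c0 : c != 0.
  by apply/eqP => c0; move: h1; rewrite XE c0 scale0r /tr2 !mxE addr0 ltxx.
have aE v (l : R) : X *m v = l *: v -> a *m v = (l / c) *: v.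
  by rewrite XE -scalemxAl => h; rewrite mulrC -scalerA -h scalerA mulVf // scale1r.
(* A multiple of the identity has zero discriminant, so the added identity cannot be the matrix
   found. *)
case: Sa => [Sa|a1]; last first.
  by move: h2; rewrite XE a1 /disc /tr2 !mxE /= !coordE; lra.
exists a, (g X); split=> //.
exists ((tr2 X - small_root X) / c), (small_root X / c), w; split.
- by split=> //; exact: aE.
- by split=> //; exact: aE.
have ci : 0 < `|c^-1| by rewrite normr_gt0 invr_eq0.
move: rr; move: (tr2 X - small_root X) => y; move: (small_root X) => x xy.
by rewrite !normrM ltr_pM2r.
Qed.

Lemma ccone_Xu u p : ccone A (outer u p) -> u != 0 -> p != 0 -> Xu A (line u).
Proof.
move=> Gup u0 p0 W /(ccone_near_unstable Gup u0 p0) [a [v [Sa uv Wv]]].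
by exists (line v); split=> //; exists v => //; exists a.
Qed.

Lemma ccone_proximal_exists u p : ccone A (outer u p) -> u != 0 -> p != 0 ->
  exists2 a, semigroup A a & proximal a.
Proof.
move=> Gup u0 p0; have [a [v [Sa [l [l' [w [e1 e2 ll]]]] _]]] := ccone_near_unstable Gup u0 p0 (@filterT _ _ _).
by exists a => //; exists l, l', v, w; split=> //; rewrite gt_eqF.
Qed.

End Perturbation.

(** * The conformal case *)

Section Conformal.
Variable R : realType.
Set Implicit Arguments. Unset Strict Implicit.
Variable A : set 'M[R]_2.
Hypothesis unitA : forall a, A a -> a \in unitmx.
Implicit Types (a b P Q X : 'M[R]_2) (u v w s p : 'cV[R]_2) (q : R * R * R).

Lemma compact_ccone_sphere : compact (ccone A `&` [set P | nM P = 1]).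
Proof.
apply: compact_mat => [|P [_ ->] //].
apply: closedI; first exact: closed_ccone.
have -> : [set P | nM P = 1 :> R] = [set P | nM P <= 1] `&` [set P : 'M[R]_2 | 1 <= nM P].
  apply/seteqP; split=> P /=; first by move=> ->.
  by move=> [h1 h2]; apply/eqP; rewrite eq_le h1.
apply: closedI.
  by apply: (closed_le_fun (f := @nM R) (g := fun=> 1)) => x; [exact: nM_continuous|exact: cst_continuous].
by apply: (closed_le_fun (g := @nM R) (f := fun=> 1)) => x; [exact: cst_continuous|exact: nM_continuous].
Qed.

(** The absolute determinant has a positive minimum on the compact unit sphere of the closed cone;
    determinant and [nM] are both homogeneous of degree two. *)
Lemma ccone_det_bound : (forall P, ccone A P -> P != 0 -> \det P != 0) ->
  exists2 d : R, 0 < d & forall a, sg1 A a -> d * nM a <= `|\det a|.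
Proof.
move=> H; pose K := ccone A `&` [set P | nM P = 1].
have cK : compact K := compact_ccone_sphere.
have norm_in P : P != 0 -> ccone A P -> K ((Num.sqrt (nM P))^-1 *: P).
  rewrite -nM_gt0 => P0 cP; split; first exact: ccone_scale.
  by rewrite /= nMZ exprVn sqr_sqrtr ?nM_ge0 // mulVf ?gt_eqF.
have sg1_in a : sg1 A a -> K ((Num.sqrt (nM a))^-1 *: a).
  move=> Sa; apply: norm_in.
    apply: contraTneq (sg1_unitmx unitA Sa) => ->.
    by rewrite unitmx_det det0 eqxx.
  by apply: cone_ccone; exists 1, a; rewrite scale1r.
have K0 : K !=set0 by exists ((Num.sqrt (nM (1%:M : 'M[R]_2)))^-1 *: 1%:M); apply: sg1_in; right.
have cf : {within K, continuous (fun P : 'M[R]_2 => `|\det P|)}.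
  by apply: continuous_subspaceT => P; apply: (@cvg_norm _ _ _ (nbhs P)); exact: det_continuous.
have [P /set_mem [cP nP] Pmin] := compact_EVT_min K0 cK cf.
have P0 : P != 0 by rewrite -nM_gt0 nP.
exists `|\det P|; first by rewrite normr_gt0 H.
move=> a Sa; have := Pmin _ (mem_set (sg1_in a Sa)).
have a0 : 0 < nM a.
  rewrite nM_gt0; apply: contraTneq (sg1_unitmx unitA Sa) => ->.
  by rewrite unitmx_det det0 eqxx.
by rewrite detZ normrM [`|_ ^+ 2|]ger0_norm ?sqr_ge0 // exprVn sqr_sqrtr ?nM_ge0 // mulrC ler_pdivlMr.
Qed.

(** A triple (x, y, z) stands for the symmetric matrix with rows (x, y) and (y, z), whose
    determinant is [qdet]. *)
Definition qform q v : R := q.1.1 * vx v ^+ 2 + 2 * q.1.2 * vx v * vy v + q.2 * vy v ^+ 2.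
Definition qdet q : R := q.1.1 * q.2 - q.1.2 ^+ 2.

Lemma qform_ge0 q v : 0 <= q.1.1 -> 0 <= q.2 -> 0 <= qdet q -> 0 <= qform q v.
Proof.
case: q => [[x y] z]; rewrite /qform /qdet /=; move: (vx v) (vy v) => s t x0 z0 d0.
have [xp|xn] := ltP 0 x.
  rewrite -(pmulr_rge0 _ xp).
  have -> : x * (x * s ^+ 2 + 2 * y * s * t + z * t ^+ 2) =
     (x * s + y * t) ^+ 2 + (x * z - y ^+ 2) * t ^+ 2 by ring.
  by apply: addr_ge0; [exact: sqr_ge0 | apply: mulr_ge0 => //; exact: sqr_ge0].
have x00 : x = 0 by apply/eqP; rewrite eq_le xn.
move: d0; rewrite x00 mul0r sub0r oppr_ge0 => y2.
have /eqP : y ^+ 2 = 0 by apply/eqP; rewrite eq_le y2 sqr_ge0.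
by rewrite sqrf_eq0 => /eqP ->; rewrite mulr0 !mul0r !add0r mulr_ge0 ?sqr_ge0.
Qed.

(* Strict concavity of the determinant on forms of equal determinant. *)
Lemma qdet_midpoint q q' (m : R) : 0 < m -> 0 <= q.1.1 -> 0 <= q'.1.1 ->
  qdet q = m -> qdet q' = m ->
  (q.1.1 + q'.1.1) * (q.2 + q'.2) - (q.1.2 + q'.1.2) ^+ 2 <= 4 * m -> q' = q.
Proof.
case: q => [[x y] z]; case: q' => [[x' y'] z']; rewrite /qdet /= => m0 x0 x0' E E' h.
have xz : 0 < x * z by have := sqr_ge0 y; lra.
have xz' : 0 < x' * z' by have := sqr_ge0 y'; lra.
have xp : 0 < x by rewrite lt0r x0 andbT; apply: contraTneq xz => ->; rewrite mul0r ltxx.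
have xp' : 0 < x' by rewrite lt0r x0' andbT; apply: contraTneq xz' => ->; rewrite mul0r ltxx.
(* The determinant fixes the last coefficient; substituting it turns the midpoint inequality into
   the nonnegativity of minus a sum of two squares. *)
have zE : z = (m + y ^+ 2) / x by rewrite -E; field; rewrite gt_eqF.
have zE' : z' = (m + y' ^+ 2) / x' by rewrite -E'; field; rewrite gt_eqF.
have h2 : 0 <= (x - x') * (z - z') - (y - y') ^+ 2 by lra.
have : 0 <= x * x' * ((x - x') * (z - z') - (y - y') ^+ 2) by rewrite mulr_ge0 // mulr_ge0.
have -> : x * x' * ((x - x') * (z - z') - (y - y') ^+ 2) =
    - (m * (x - x') ^+ 2) - (x * y' - x' * y) ^+ 2.
  by rewrite zE zE'; field; rewrite !gt_eqF.
move=> h3.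
have h4 : 0 <= m * (x - x') ^+ 2 by rewrite mulr_ge0 ?sqr_ge0 // ltW.
have h5 := sqr_ge0 (x * y' - x' * y).
have /eqP : m * (x - x') ^+ 2 = 0 by lra.
rewrite mulf_eq0 gt_eqF //= sqrf_eq0 subr_eq0 => /eqP xx.
have /eqP : (x * y' - x' * y) ^+ 2 = 0 by lra.
rewrite sqrf_eq0 -xx -mulrBr mulf_eq0 gt_eqF //= subr_eq0 => /eqP yy.
by rewrite zE zE' -xx yy.
Qed.

(* q v <= sup over a of nV (a v) / |det a|, phrased through upper bounds t. *)
Definition qsub q : Prop := forall v t,
  (forall a, sg1 A a -> nV (a *m v) <= t * `|\det a|) -> qform q v <= t.

(** Admissible forms make up a compact set: the determinant bound caps the diagonal entries by
    [d^-1], and [0 <= qdet q] then caps the off-diagonal one. The identity in [sg1] makes the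
    Euclidean form admissible, so the maximum is positive. *)
Lemma max_form : (exists2 d : R, 0 < d & forall a, sg1 A a -> d * nM a <= `|\det a|) ->
  exists q, [/\ 0 < qdet q, 0 <= q.1.1, 0 <= q.2, qsub q &
    forall q', 0 <= q'.1.1 -> 0 <= q'.2 -> 0 <= qdet q' -> qsub q' -> qdet q' <= qdet q].
Proof.
move=> [d d0 Hd].
pose K := [set q | 0 <= q.1.1] `&` [set q | 0 <= q.2] `&` [set q | 0 <= qdet q] `&` [set q | qsub q].
have c1 : continuous (fun q => q.1.1).
  by move=> q; apply: (@cvg_comp _ _ _ fst fst (nbhs q)); [exact: cvg_fst|exact: cvg_fst].
have c2 : continuous (fun q => q.1.2).
  by move=> q; apply: (@cvg_comp _ _ _ fst snd (nbhs q)); [exact: cvg_fst|exact: cvg_snd].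
have c3 : continuous (fun q => q.2) by move=> q; exact: cvg_snd.
have cd : continuous qdet.
  move=> q; rewrite /qdet /continuous_at.
  under eq_cvg do rewrite expr2; rewrite expr2.
  by apply: (@cvgB _ _ _ (nbhs q)); apply: (@cvgM _ _ (nbhs q)); first [exact: c1|exact: c2|exact: c3].
have cq v : continuous (qform^~ v).
  move=> q; rewrite /qform; apply: (@cvgD _ _ _ (nbhs q)); first apply: (@cvgD _ _ _ (nbhs q)).
  - by apply: (@cvgM _ _ (nbhs q)); [exact: c1|exact: cst_continuous].
  - do 2?[apply: (@cvgM _ _ (nbhs q)); last exact: cst_continuous].
    by apply: (@cvgM _ _ (nbhs q)); [exact: cst_continuous|exact: c2].
  - by apply: (@cvgM _ _ (nbhs q)); [exact: c3|exact: cst_continuous].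
have c0 (x : R) : continuous (fun _ : R * R * R => x) by exact: cst_continuous.
have clK : closed K.
  apply: closedI; last first.
    have -> : [set q | qsub q] = \bigcap_(v in setT) \bigcap_(t in [set t |
        forall a, sg1 A a -> nV (a *m v) <= t * `|\det a|]) [set q | qform q v <= t].
      by apply/seteqP; split=> q h v => [_ t ht|t ht]; exact: h.
    apply: closed_bigI => v _; apply: closed_bigI => t _.
    exact: (closed_le_fun (cq v) (c0 t)).
  apply: closedI; last exact: (closed_le_fun (c0 0) cd).
  by apply: closedI; [exact: (closed_le_fun (c0 0) c1)|exact: (closed_le_fun (c0 0) c3)].
pose C := d^-1.
have bK v : nV v = 1 -> forall q, K q -> qform q v <= C.
  move=> v1 q [_ qs]; apply: qs => a Sa; rewrite mulrC ler_pdivlMr // mulrC.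
  apply: le_trans (Hd a Sa); rewrite ler_pM2l //.
  by apply: le_trans (nV_mul _ _) _; rewrite v1 mulr1.
have b1 q : K q -> q.1.1 <= C.
  have e : nV (mkv 1 0) = 1 :> R by rewrite nV_mkv; ring.
  by move=> /(bK _ e); rewrite /qform vx_mkv vy_mkv; lra.
have b2 q : K q -> q.2 <= C.
  have e : nV (mkv 0 1) = 1 :> R by rewrite nV_mkv; ring.
  by move=> /(bK _ e); rewrite /qform vx_mkv vy_mkv; lra.
have cpK : compact K.
  apply: (@subclosed_compact _ _ ((`[0, C] `*` `[- C, C]) `*` `[0, C])) => //.
    by apply: compact_setX; first apply: compact_setX; exact: segment_compact.
  move=> q Kq; have h1 := b1 q Kq; have h2 := b2 q Kq.
  case: Kq => [[[/= x0 z0] d1] _].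
  split; rewrite /= ?in_itv /= ?z0 //; split; rewrite /= ?in_itv /= ?x0 //.
  rewrite -ler_norml -ler_sqr ?nnegrE ?real_normK ?num_real //; last exact: le_trans h1.
  apply: (@le_trans _ _ (q.1.1 * q.2)); first by move: d1; rewrite /qdet subr_ge0.
  by rewrite expr2 ler_pM.
have K1 : K (1, 0, 1).
  do 3?split; rewrite /= /qdet /= ?expr0n ?mulr1 ?subr0 //.
  move=> v t h; have := h 1%:M (or_intror erefl); rewrite mul1mx det1 normr1 mulr1.
  by apply: le_trans; rewrite /qform /nV /=; lra.
have [q /set_mem qK qmax] := compact_EVT_max (ex_intro _ _ K1) cpK (continuous_subspaceT cd).
case: (qK) => [[[x0 z0] d1] qs].
exists q; split=> //.
  by apply: lt_le_trans (qmax _ (mem_set K1)); rewrite /qdet /= expr0n mulr1 subr0.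
by move=> q' x0' z0' d' qs'; apply: qmax; apply: mem_set.
Qed.

(** Dividing by the absolute determinant makes the pullback preserve [qdet] and agrees with the
    weight in [qsub]. *)
Definition qpull (b : 'M[R]_2) q : R * R * R :=
  let v := b *m mkv 1 0 in let w := b *m mkv 0 1 in
  ((qform q v / `|\det b|,
   (q.1.1 * vx v * vx w + q.1.2 * (vx v * vy w + vx w * vy v) + q.2 * vy v * vy w) / `|\det b|),
   qform q w / `|\det b|).

Lemma qform_pull b q v : qform (qpull b q) v = qform q (b *m v) / `|\det b|.
Proof.
rewrite /qpull /qform /=; move: (`|_|^-1) => D; move: b v; apply: mat_elim => ? ? ? ?; apply: vec_elim => ? ?.
by rewrite !coordE; ring.
Qed.

Lemma qdet_pull b q : b \in unitmx -> qdet (qpull b q) = qdet q.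
Proof.
rewrite unitmx_det => b0.
have n0 : `|\det b| != 0 by rewrite normr_eq0.
rewrite /qdet /qpull /qform /=.
transitivity ((q.1.1 * q.2 - q.1.2 ^+ 2) * (\det b) ^+ 2 / (`|\det b| ^+ 2)); last first.
  by rewrite real_normK ?num_real // mulfK // expf_neq0.
move: n0; move: (`|\det b|) => D D0; move: b {b0}; apply: mat_elim => ? ? ? ?; rewrite !coordE.
by field.
Qed.

(** Pulling back by [b] replaces [a] by [a *m b] in the constraints, so it keeps forms admissible
    and maps the maximiser to a maximiser; uniqueness gives invariance. *)
Lemma conformal_form : (exists2 d : R, 0 < d & forall a, sg1 A a -> d * nM a <= `|\det a|) ->
  exists q, [/\ 0 < qdet q, 0 <= q.1.1, 0 <= q.2 & forall b, A b -> qpull b q = q].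
Proof.
move=> /max_form [q [d0 x0 z0 qs qmax]]; exists q; split=> // b Ab.
have ub := unitA Ab.
have nb : 0 < `|\det b| by rewrite normr_gt0 -unitmx_det.
have h11 : 0 <= (qpull b q).1.1 by rewrite /qpull /= divr_ge0 // qform_ge0 // ltW.
have h2 : 0 <= (qpull b q).2 by rewrite /qpull /= divr_ge0 // qform_ge0 // ltW.
have hs : qsub (qpull b q).
  move=> v t h; rewrite qform_pull ler_pdivrMr //; apply: qs => a Sa.
  rewrite mulmxA -mulrA -normrM mulrC mulrC [\det b * _]mulrC -det_mulmx; apply: h.
  by apply: sg1_mulmx => //; left; exact: sg_gen.
have dE := qdet_pull q ub.
move: (qpull b q) h11 h2 hs dE => q' h11 h2 hs dE.
apply: (@qdet_midpoint _ _ (qdet q)) => //.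
(* Admissibility is convex, so a midpoint of nonnegative determinant is admissible and maximality
   bounds its determinant, as [qdet_midpoint] requires. *)
pose mid := ((q.1.1 + q'.1.1) / 2, (q.1.2 + q'.1.2) / 2, (q.2 + q'.2) / 2).
have -> : (q.1.1 + q'.1.1) * (q.2 + q'.2) - (q.1.2 + q'.1.2) ^+ 2 = 4 * qdet mid.
  by rewrite /qdet /=; field.
rewrite ler_pM2l //; have [dm|/ltW dm] := leP 0 (qdet mid); last by apply: le_trans dm (ltW d0).
apply: qmax => //=; [by rewrite divr_ge0 ?addr_ge0 | by rewrite divr_ge0 ?addr_ge0 |].
by move=> v t h; have := qs v t h; have := hs v t h; rewrite /qform /=; lra.
Qed.

(** [M] is the upper triangular Cholesky factor of the matrix [S] of the form. Invariance of [S]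
    under [b] says that the normalised conjugate of [b] by [M] is orthogonal. *)
Lemma strongly_conformal_of_form q : 0 < qdet q -> 0 <= q.1.1 -> 0 <= q.2 ->
  (forall b, A b -> qpull b q = q) -> strongly_conformal A.
Proof.
case: q => [[x y] z] d0 x0 z0 H; rewrite /qdet /= in d0 x0 z0.
have xz : 0 < x * z by have := sqr_ge0 y; lra.
have xp : 0 < x by rewrite lt0r x0 andbT; apply: contraTneq xz => ->; rewrite mul0r ltxx.
pose r := Num.sqrt x; pose s := Num.sqrt ((x * z - y ^+ 2) / x).
have r0 : 0 < r by rewrite sqrtr_gt0.
have s0 : 0 < s by rewrite sqrtr_gt0 divr_gt0.
have r2 : r * r = x by rewrite -expr2 sqr_sqrtr.
have s2 : s * s = (x * z - y ^+ 2) / x by rewrite -expr2 sqr_sqrtr // ltW // divr_gt0.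
pose M := M4 r (y / r) 0 s.
have uM : M \in unitmx by rewrite unitmx_det !coordE mulr0 subr0 mulf_neq0 ?gt_eqF.
pose S := M4 x y y z.
have MS : M^T *m M = S.
  rewrite /M /S !coordE; congr M4.
  - by rewrite r2; ring.
  - by field; rewrite gt_eqF.
  - by field; rewrite gt_eqF.
  have -> : y / r * (y / r) = y ^+ 2 / x by rewrite -r2; field; rewrite gt_eqF.
  by rewrite s2; field; rewrite gt_eqF.
exists M => // b Ab Q.
have nb : 0 < `|\det b| by rewrite normr_gt0 -unitmx_det unitA.
have bS : b^T *m S *m b = `|\det b| *: S.
  have := H _ Ab; rewrite /qpull /qform /= => -[].
  move: nb; move: (`|_|) => D D0.
  have D1 : D != 0 by rewrite gt_eqF.
  rewrite /S; move: (b); apply: mat_elim => e f g h; rewrite !coordE => E1 E2 E3.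
  congr M4.
  - by rewrite -[in RHS]E1; field.
  - by rewrite -[in RHS]E2; field.
  - by rewrite -[in RHS]E2; field.
  - by rewrite -[in RHS]E3; field.
have QQ : Q^T *m Q = 1%:M.
  have -> : Q^T = (Num.sqrt `|\det b|)^-1 *: (M *m b *m invmx M)^T by rewrite /Q linearZ.
  rewrite /Q -scalemxAl -scalemxAr scalerA -expr2 exprVn sqr_sqrtr ?ltW //.
  rewrite !trmx_mul.
  have -> : (invmx M)^T *m (b^T *m M^T) *m (M *m b *m invmx M) =
      (invmx M)^T *m (b^T *m (M^T *m M) *m b) *m invmx M by rewrite !mulmxA.
  rewrite MS bS -scalemxAr -scalemxAl scalerA mulVf ?gt_eqF // scale1r -MS.
  by rewrite mulmxA -trmx_mul mulmxV // trmx1 mul1mx mulmxV.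
exact: mulmx1C.
Qed.


End Conformal.

(** * Finite unions of arcs *)

Section Arcs.
Variable R : realType.
Set Implicit Arguments. Unset Strict Implicit.
Implicit Types (u v w e f : 'cV[R]_2) (z : R * R) (D K : set (R * R)).

Definition circ (t : R) : R * R := line (mkv (cos t) (sin t)).

(* The affine function on the plane that vanishes on the chord joining the points
   line e and line f of the circle. *)
Definition chord e f z : R :=
  - ((1 - z.1) / 2 * (vx e * vx f) - z.2 / 2 * (vx e * vy f + vy e * vx f)
     + (1 + z.1) / 2 * (vy e * vy f)).

(** Hence [chord] is positive exactly when [crs e v] and [crs f v] have opposite signs, which
    singles out one side of the chord. *)
Lemma chord_line e f v : v != 0 -> chord e f (line v) = - (crs e v * crs f v) / nV v.
Proof.
rewrite -nV_gt0; move: e f v; apply: vec_elim => ? ?; apply: vec_elim => ? ?; apply: vec_elim => ? ?.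
rewrite /chord /line /crs nV_mkv !coordE /= => n0.
by field; rewrite gt_eqF.
Qed.

Lemma chord_continuous e f : continuous (chord e f).
Proof.
have c0 (x : R) : continuous (fun _ : R * R => x) by exact: cst_continuous.
have c1 : continuous (fun z : R * R => z.1) by move=> z; exact: cvg_fst.
have c2 : continuous (fun z : R * R => z.2) by move=> z; exact: cvg_snd.
move=> z; apply: (@cvgN _ _ _ (nbhs z)); apply: (@cvgD _ _ _ (nbhs z)).
  apply: (@cvgB _ _ _ (nbhs z)); apply: (@cvgM _ _ (nbhs z)); last exact: c0.
  - apply: (@cvgM _ _ (nbhs z)); last exact: c0.
    by apply: (@cvgB _ _ _ (nbhs z)); [exact: c0 | exact: c1].
  - exact: c0.
  by apply: (@cvgM _ _ (nbhs z)); [exact: c2 | exact: c0].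
apply: (@cvgM _ _ (nbhs z)); last exact: c0.
apply: (@cvgM _ _ (nbhs z)); last exact: c0.
by apply: (@cvgD _ _ _ (nbhs z)); [exact: c0 | exact: c1].
Qed.

(** On the circle [chord] vanishes only at the two end points; by intermediate values a connected
    set avoiding both stays on one side. *)
Lemma connected_chord K e f x : connected K -> K `<=` @S1 R -> e != 0 -> f != 0 ->
  ~ K (line e) -> ~ K (line f) -> K x -> 0 < chord e f x ->
  forall y, K y -> 0 < chord e f y.
Proof.
move=> cK KS e0 f0 Ke Kf Kx x0 y Ky; rewrite ltNge; apply/negP => y0.
have cI : connected (chord e f @` K).
  by apply: connected_continuous_connected cK _; exact/continuous_subspaceT/chord_continuous.
have /connected_intervalP iI := cI.
have [z Kz z0] : (chord e f @` K) 0.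
  by apply: (iI (chord e f y) (chord e f x)); [exists y|exists x|rewrite y0 ltW].
have [t _ zt] := S1_line (KS _ Kz).
move: z0; rewrite zt chord_line ?cossin_neq0 // nV_cossin divr1 => /eqP.
rewrite oppr_eq0 mulf_eq0 => /orP[|] /eqP h.
  by apply: Ke; rewrite (line_eq e0 (cossin_neq0 t) h) -zt.
by apply: Kf; rewrite (line_eq f0 (cossin_neq0 t) h) -zt.
Qed.

(** If [e] and [f] make an angle of at most pi/2, a line on the positive side is no farther from [e]
    than [f] is. *)
Lemma chord_cap e f v : nV e = 1 -> nV f = 1 -> 0 <= dot e f -> v != 0 ->
  0 < chord e f (line v) -> crs e v ^+ 2 <= crs e f ^+ 2 * nV v.
Proof.
move=> e1 f1 ef v0; have n0 : 0 < nV v by rewrite nV_gt0.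
rewrite chord_line // pmulr_lgt0 ?invr_gt0 // oppr_gt0 => ab.
(* Squared norm of the Cramer relation crs f v * e - crs e v * f = - crs e f * v. *)
have id : nV e * crs f v ^+ 2 + nV f * crs e v ^+ 2 - 2 * (crs e v * crs f v) * dot e f
    = nV v * crs e f ^+ 2 by rewrite /nV /crs /dot; ring.
have h : crs e v * crs f v * dot e f <= 0 by rewrite mulr_le0_ge0 // ltW.
have := sqr_ge0 (crs f v); rewrite mulrC -id e1 f1; lra.
Qed.

Lemma crs_triangle e v w (c : R) : nV e = 1 ->
  crs e v ^+ 2 <= c * nV v -> crs e w ^+ 2 <= c * nV w -> 0 <= c ->
  crs v w ^+ 2 <= 4 * c * (nV v * nV w).
Proof.
move=> e1 hv hw c0.
have id : nV e * crs v w = dot e v * crs e w - crs e v * dot e w by rewrite /nV /crs /dot; ring.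
rewrite e1 mul1r in id.
have dle x : dot e x ^+ 2 <= nV x.
  have : dot e x ^+ 2 + crs e x ^+ 2 = nV e * nV x by rewrite /dot /crs /nV; ring.
  by rewrite e1 mul1r => <-; rewrite lerDl sqr_ge0.
have h1 : dot e v ^+ 2 * crs e w ^+ 2 <= nV v * (c * nV w) by rewrite ler_pM ?sqr_ge0.
have h2 : crs e v ^+ 2 * dot e w ^+ 2 <= c * nV v * nV w by rewrite ler_pM ?sqr_ge0.
have := sqr_ge0 (dot e v * crs e w + crs e v * dot e w).
rewrite id; lra.
Qed.

(** The empty list is allowed here, since a cell of the subdivision may miss the set. *)
Definition fin_arcs (X : set (R * R)) := exists s : seq (R * R),
  (forall ab, ab \in s -> ab.1 <= ab.2) /\
  X = \bigcup_(ab in [set ab | ab \in s]) pinterval ab.1 ab.2.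

Lemma fin_arcs0 : fin_arcs set0.
Proof. by exists [::]; split=> //; apply/seteqP; split=> x // [ab]. Qed.

Lemma fin_arcs1 a b : a <= b -> fin_arcs (pinterval a b).
Proof.
move=> ab; exists [:: (a, b)]; split=> [p|]; first by rewrite inE => /eqP ->.
apply/seteqP; split=> x; first by exists (a, b) => //=; rewrite inE.
by move=> [p /=]; rewrite inE => /eqP ->.
Qed.

Lemma fin_arcsU X Y : fin_arcs X -> fin_arcs Y -> fin_arcs (X `|` Y).
Proof.
move=> [s [hs ->]] [t [ht ->]]; exists (s ++ t); split=> [p|].
  by rewrite mem_cat => /orP[/hs|/ht].
apply/seteqP; split=> x.
  by move=> [[p /= ps xp]|[p /= ps xp]]; exists p => //=; rewrite mem_cat ps ?orbT.
by move=> [p /=]; rewrite mem_cat => /orP[ps|ps] xp; [left|right]; exists p.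
Qed.

(** The end points of initial intervals inside [E] have a supremum, which is itself such an end
    point because [E] is closed. *)
Lemma max_prefix (E : set R) a b : closed E -> a <= b -> E a ->
  exists l, [/\ a <= l <= b, (forall p, a <= p <= l -> E p) &
    forall x, a <= x <= b -> (forall p, a <= p <= x -> E p) -> x <= l].
Proof.
move=> cE ab Ea.
pose L := [set x | a <= x <= b /\ forall p, a <= p <= x -> E p].
have La : L a.
  split; first by rewrite lexx.
  by move=> p; rewrite -eq_le => /eqP <-.
have uL : has_ubound L by exists b => x [/andP[]].
have al : a <= sup L by exact: ub_le_sup.
have lb : sup L <= b by apply: (ge_sup (ex_intro _ a La)) => x [/andP[]].
have clo : closure L (sup L) by apply: closure_sup => //; exists a.
exists (sup L); split; first by rewrite al.
  move=> p /andP[ap]; rewrite le_eqVlt => /orP[/eqP ->|pl].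
    apply: cE; apply: closure_subset clo => x [/andP[ax _] H]; apply: H.
    by rewrite ax lexx.
  have d0 : 0 < sup L - p by rewrite subr_gt0.
  have [x [_ Lx] px] := sup_adherent d0 (conj (ex_intro _ a La) uL).
  by apply: Lx; rewrite ap ltW //; apply: le_lt_trans px; rewrite opprB addrC subrK.
by move=> x ax H; apply: ub_le_sup.
Qed.

Lemma circ_continuous : continuous circ.
Proof.
move=> t; apply: (@cvg_line _ _ (nbhs t)); first exact: cossin_neq0.
by apply: (@cvg_mkv _ _ (nbhs t)); [exact: continuous_cos | exact: continuous_sin].
Qed.

Lemma crs_circ (a b : R) : crs (mkv (cos a) (sin a)) (mkv (cos b) (sin b)) = sin (b - a).
Proof. by rewrite /crs !coordE sinB; ring. Qed.

Lemma dot_circ (a b : R) : dot (mkv (cos a) (sin a)) (mkv (cos b) (sin b)) = cos (b - a).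
Proof. by rewrite /dot !coordE cosB; ring. Qed.

(** Under the dichotomy the part of [D] in the cell is an initial interval together with a final
    one, either possibly empty. *)
Lemma fin_arcs_cell D a b : closed D -> a <= b ->
  (forall x, a <= x <= b -> D (circ x) ->
     (forall p, a <= p <= x -> D (circ p)) \/ (forall p, x <= p <= b -> D (circ p))) ->
  fin_arcs [set circ x | x in [set x | a <= x <= b /\ D (circ x)]].
Proof.
move=> cD ab H.
have cE : closed [set x | D (circ x)] by exact: (closed_preimage (f := circ) circ_continuous cD).
have cE' : closed [set x | D (circ (- x))].
  apply: (closed_preimage (f := fun x => circ (- x))) cD => x.
  by apply: (@cvg_comp _ _ _ -%R circ (nbhs x)); [exact: opp_continuous | exact: circ_continuous].
have [Y1 F1 E1] : exists2 Y, fin_arcs Y & Y = [set circ x | x in [set x | a <= x <= b /\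
    forall p, a <= p <= x -> D (circ p)]].
  eexists; last reflexivity.
  have [Da|nDa] := pselect (D (circ a)); last first.
    suff -> : [set circ x | x in [set x | a <= x <= b /\
      forall p, a <= p <= x -> D (circ p)]] = set0 by exact: fin_arcs0.
    apply/seteqP; split=> // z [x [/andP[ax _] h] _]; case: nDa; apply: h.
    by rewrite lexx.
  have [l [/andP[al lb] h1 h2]] := max_prefix cE ab Da.
  suff -> : [set circ x | x in [set x | a <= x <= b /\
      forall p, a <= p <= x -> D (circ p)]] = pinterval a l by exact: fin_arcs1.
  apply/seteqP; split=> _ [x hx <-]; exists x => //=; move: hx; rewrite /= ?in_itv /=.
    by move=> [h3 h4]; rewrite h2 // andbT; case/andP: h3.
  move=> /andP[ax xl]; rewrite ax (le_trans xl lb); split=> // p /andP[ap px]; apply: h1.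
  by rewrite ap (le_trans px xl).
have [Y2 F2 E2] : exists2 Y, fin_arcs Y & Y = [set circ x | x in [set x | a <= x <= b /\
    forall p, x <= p <= b -> D (circ p)]].
  eexists; last reflexivity.
  have [Db|nDb] := pselect (D (circ b)); last first.
    suff -> : [set circ x | x in [set x | a <= x <= b /\
      forall p, x <= p <= b -> D (circ p)]] = set0 by exact: fin_arcs0.
    apply/seteqP; split=> // z [x [/andP[_ xb] h] _]; case: nDb; apply: h.
    by rewrite lexx andbT.
  (* Reflection in 0 turns final intervals ending at [b] into initial ones. *)
  have nab : - b <= - a by rewrite lerN2.
  have Db' : D (circ (- - b)) by rewrite opprK.
  have [l [/andP[al lb] h1 h2]] := max_prefix cE' nab Db'.
  suff -> : [set circ x | x in [set x | a <= x <= b /\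
      forall p, x <= p <= b -> D (circ p)]] = pinterval (- l) b by apply: fin_arcs1; lra.
  apply/seteqP; split=> _ [x hx <-]; exists x => //=; move: hx; rewrite /= ?in_itv /=.
    move=> [/andP[ax xb] h4]; rewrite xb andbT; suff : - x <= l by lra.
    apply: h2; first by lra.
    by move=> p hp; apply: h4; lra.
  move=> /andP[ax xl]; split; first by lra.
  by move=> p hp; rewrite -[p]opprK; apply: h1; lra.
suff -> : [set circ x | x in [set x | a <= x <= b /\ D (circ x)]] = Y1 `|` Y2 by exact: fin_arcsU.
rewrite E1 E2; apply/seteqP; split=> [_ [x [ax Dx] <-]|z].
  by case: (H x ax Dx) => h; [left|right]; exists x.
move=> [[x [ax h] <-]|[x [ax h] <-]]; exists x => //; split=> //; apply: h; rewrite lexx ?andbT //.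
  by case/andP: ax.
by case/andP: ax.
Qed.

(* Every point is connected inside D to two points at a definite angle; this bounds
   the number of components of D. *)
Definition spread (d : R) D := forall x, D x -> exists K v0 v1,
  [/\ connected K, K `<=` D, K x & [/\ v0 != 0, v1 != 0, K (line v0), K (line v1) &
     d * (nV v0 * nV v1) <= crs v0 v1 ^+ 2]].

(** If [D] missed points on both sides of [x] in the cell, the connected set through [x] would be
    trapped between them, on an arc too short for its two spread points. *)
Lemma cell_dichotomy (d : R) D a b : D `<=` @S1 R -> spread d D -> b - a < pi / 2 ->
  (forall t, 0 < t <= b - a -> 4 * sin t ^+ 2 < d) ->
  forall x, a <= x <= b -> D (circ x) ->
     (forall p, a <= p <= x -> D (circ p)) \/ (forall p, x <= p <= b -> D (circ p)).
Proof.
move=> DS sD ba small x /andP[ax xb] Dx.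
apply: contrapT => /not_orP[/existsNP[p /not_implyP[/andP[ap px] Dp]]
   /existsNP[q /not_implyP[/andP[xq qb] Dq]]].
have px' : p < x by rewrite lt_neqAle px andbT; apply: contra_notN Dp => /eqP ->.
have xq' : x < q by rewrite lt_neqAle xq andbT; apply: contra_notN Dq => /eqP <-.
have [K [v0 [v1 [cK KD Kx [v00 v10 K0 K1 big]]]]] := sD _ Dx.
have pi0 := pi_gt0 R.
pose e := mkv (cos p) (sin p); pose f := mkv (cos q) (sin q).
have pos : 0 < chord e f (circ x).
  rewrite chord_line ?cossin_neq0 // nV_cossin divr1 !crs_circ -mulrN -sinN opprB.
  by rewrite mulr_gt0 // sin_gt0_pi //; lra.
have all_pos := connected_chord cK (subset_trans KD DS) (cossin_neq0 p) (cossin_neq0 q)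
  (contra_not (KD _) Dp) (contra_not (KD _) Dq) Kx pos.
have ef : 0 <= dot e f by rewrite dot_circ; apply/ltW/cos_gt0_pihalf; lra.
have b0 := chord_cap (nV_cossin p) (nV_cossin q) ef v00 (all_pos _ K0).
have b1 := chord_cap (nV_cossin p) (nV_cossin q) ef v10 (all_pos _ K1).
have := crs_triangle (nV_cossin p) b0 b1 (sqr_ge0 _).
move=> /(le_trans big); rewrite ler_pM2r ?mulr_gt0 ?nV_gt0 // crs_circ.
by rewrite leNgt small //; lra.
Qed.

(** The half turn [0, pi] parametrises the whole circle. It is covered by finitely many cells
    shorter than the spread allows, each contributing at most two arcs. *)
Lemma closed_spread_fin_arcs (d : R) D : 0 < d -> D `<=` @S1 R -> closed D -> spread d D ->
  fin_arcs D.
Proof.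
move=> d0 DS cD sD; have pi0 := pi_gt0 R.
have [h h0 [h1 hs]] : exists2 h : R, 0 < h & h < pi / 2 /\ forall t, 0 < t <= h -> 4 * sin t ^+ 2 < d.
  have c : 4 * (sin t * sin t) @[t --> nbhs (0 : R)] --> 4 * (sin 0 * sin 0 : R).
    apply: (@cvgM _ _ (nbhs (0 : R))); first exact: cst_continuous.
    by apply: (@cvgM _ _ (nbhs (0 : R))); exact: continuous_sin.
  rewrite sin0 !mulr0 in c.
  have /nbhs_ballP[r /= r0 Hr] : nbhs (0 : R) [set t | 4 * (sin t * sin t) < d].
    exact: (@cvgr_lt _ _ (nbhs (0 : R)) _ _ _ c d d0).
  (* The bound [r / 2] keeps the angle inside the ball, and [pi / 4] keeps the cells shorter than a
     right angle. *)
  exists (Num.min (r / 2) (pi / 4)); first by rewrite lt_min !divr_gt0.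
  split; first by rewrite gt_min; apply/orP; right; lra.
  move=> t /andP[t0]; rewrite expr2 le_min => /andP[tr _]; apply: Hr.
  by rewrite /ball /= sub0r normrN gtr0_norm //; lra.
have step n : fin_arcs [set circ x | x in [set x | 0 <= x <= n%:R * h /\ D (circ x)]].
  elim: n => [|n IH].
    apply: fin_arcs_cell => //; first by rewrite mul0r.
    by apply: (cell_dichotomy DS sD); rewrite mul0r subr0 ?divr_gt0 // => t; lra.
  have cell : fin_arcs [set circ x | x in [set x | n%:R * h <= x <= n.+1%:R * h /\ D (circ x)]].
    apply: fin_arcs_cell => //; first by rewrite ler_pM2r // ler_nat.
    by apply: (cell_dichotomy DS sD); rewrite -mulrBl -natrB // subSnn mul1r.
  have := fin_arcsU IH cell; congr fin_arcs.
  have nh : 0 <= n%:R * h by rewrite mulr_ge0 // ltW.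
  have nh' : n%:R * h <= n.+1%:R * h by rewrite ler_pM2r // ler_nat.
  apply/seteqP; split=> [_ [[x [hx Dx] <-]|[x [hx Dx] <-]]|_ [x [hx Dx] <-]].
  - by exists x => //; split=> //; lra.
  - by exists x => //; split=> //; lra.
  have [xn|xn] := leP x (n%:R * h); [left|right]; exists x => //; split=> //; lra.
pose n := Num.bound (pi / h).
have nh : pi <= n%:R * h by rewrite -ler_pdivrMr // ltW // archi_boundP // divr_ge0 // ltW.
have := step n; congr fin_arcs; apply/seteqP; split=> [_ [x [_ Dx] <-] //|z Dz].
have [t /andP[t0 tp] zt] := S1_line (DS _ Dz).
by exists t => //; split; rewrite /circ -?zt // t0 (le_trans tp nh).
Qed.

End Arcs.

(** * The multicone *)

Section Multicone.
Variable R : realType.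
Set Implicit Arguments. Unset Strict Implicit.
Variables (A : set 'M[R]_2) (k : R).
Hypothesis k0 : 0 < k <= 1 / 2.
Hypothesis unitA : forall a, A a -> a \in unitmx.
Hypothesis Ak : forall a b, sg1 A a -> sg1 A b -> k * nM a * nM b <= nM (a *m b).
Hypothesis singular : exists P, [/\ ccone A P, P != 0 & \det P = 0].
Implicit Types (a b P Q X : 'M[R]_2) (u v w s p : 'cV[R]_2).

Definition unstable_dir u p : Prop := [/\ ccone A (outer u p), u != 0 & p != 0].

(** The squared sine of the angle is at most [k ^+ 2 / 8], the threshold of
    [outer_cone_transversality]. *)
Definition near_dir u v : Prop := v != 0 /\ crs u v ^+ 2 <= k ^+ 2 / 8 * (nV u * nV v).

Definition orbit_cone : set (R * R) := [set z | exists P u p v,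
  [/\ ccone A P, P != 0, unstable_dir u p, near_dir u v & z = line (P *m v)]].

Let kp : 0 < k. Proof. by case/andP: k0. Qed.
Let kh : k <= 1 / 2. Proof. by case/andP: k0. Qed.
Let k2p : 0 < k ^+ 2. Proof. by rewrite exprn_gt0. Qed.
Let k2h : k ^+ 2 <= 1 / 4.
Proof.
have -> : 1 / 4 = (1 / 2) ^+ 2 :> R by field.
by rewrite lerXn2r ?nnegrE ?(ltW kp) ?divr_ge0.
Qed.

(** Lets any row factor be written as [orth s], the form in which the transversality estimates are
    stated. *)
Lemma orthK p : orth (- orth p) = p.
Proof. by move: p; apply: vec_elim => ? ?; rewrite /orth !coordE !opprK. Qed.

Lemma unstable_dir_exists : exists u p, unstable_dir u p.
Proof.
have [P [cP P0 dP]] := singular; have [u [p [u0 p0 E]]] := det0_outer P0 dP.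
by exists u, p; split=> //; rewrite -E.
Qed.

Lemma unstable_dir_image P u p : ccone A P -> unstable_dir u p -> P *m u != 0 ->
  unstable_dir (P *m u) p.
Proof. by move=> cP [cu u0 p0] Pu; split=> //; rewrite -mul_outer; exact: ccone_mul. Qed.

Lemma orbit_neq0 P u p v : ccone A P -> P != 0 -> unstable_dir u p -> near_dir u v ->
  P *m v != 0.
Proof.
move=> cP P0 [cu u0 p0] [v0 uv].
(* Any rank-one outer w q in the closed cone has a kernel, which the orbit must avoid. *)
have [w [q [cw w0 q0]]] := unstable_dir_exists.
have cw' : ccone A (outer w (orth (- orth q))) by rewrite orthK.
have h := outer_cone_transversality k0 Ak cP cu p0 u0 cw' w0 uv.
apply: contraTneq h => ->; rewrite -ltNge.
have -> : crs (- orth q) 0 = 0 by rewrite -(scale0r 0) crsZr mul0r.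
have s0 : 0 < nV (- orth q).
  move: q0; rewrite -nV_gt0; apply: etrans; congr (_ < _).
  by move: q {cw cw'}; apply: vec_elim => ? ?; rewrite /orth !coordE !nV_mkv; ring.
have nP : 0 < nM P by rewrite nM_gt0.
have nv : 0 < nV v by rewrite nV_gt0.
by rewrite expr0n /=; apply: mulr_gt0; [rewrite divr_gt0 | rewrite !mulr_gt0].
Qed.

Lemma near_dir_refl u : u != 0 -> near_dir u u.
Proof.
move=> u0; split=> //; rewrite crsvv expr0n /=; apply: mulr_ge0.
  by rewrite divr_ge0 // sqr_ge0.
by rewrite mulr_ge0 ?nV_ge0.
Qed.

Lemma orbit_cone_S1 : orbit_cone `<=` @S1 R.
Proof.
by move=> z [P [u [p [v [cP P0 up uv ->]]]]]; apply: line_S1; exact: orbit_neq0 up uv.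
Qed.

Lemma orbit_cone_invariant : invariant_for A orbit_cone.
Proof.
move=> a v Aa v0 [P [u [p [w [cP P0 up uw E]]]]].
have Pw0 := orbit_neq0 cP P0 up uw.
have [c vE] : exists c : R, v = c *: (P *m w).
  by apply: crs_par => //; apply: line_eq_crs.
have c0 : c != 0 by apply: contraNneq v0 => c0; rewrite vE c0 scale0r.
have ua := unitA Aa.
have ca : ccone A a by apply/cone_ccone/cone_sg; exact: sg_gen.
exists (a *m P), u, p, w; split=> //; first exact: ccone_mul.
  by apply: contraNneq P0 => aP; rewrite -[P]mul1mx -(mulVmx ua) -mulmxA aP mulmx0.
by rewrite vE -scalemxAr lineZ ?mulmxA //; rewrite -mulmxA unitmx_neq0.
Qed.

(** The segment from [u] to [v] stays near [u], so [P] maps it into the cone of orbits without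
    meeting zero. *)
Lemma orbit_cone_path P u p v : ccone A P -> P != 0 -> unstable_dir u p -> near_dir u v ->
  exists K, [/\ connected K, K `<=` orbit_cone, K (line (P *m u)) & K (line (P *m v))].
Proof.
move=> cP P0 up uv.
(* Replacing [v] by its opposite leaves its line unchanged and keeps the segment away from 0. *)
wlog uv0 : v uv / 0 <= dot u v.
  move=> H; have [d0|/ltW d0] := leP 0 (dot u v); first exact: H.
  have [v0 c] := uv.
  have [||K [cK KD Ku Kv]] := H (-1 *: v).
  - by split; [rewrite scaler_eq0 negb_or v0 oppr_eq0 oner_eq0 | rewrite crsZr nVZ !mulN1r !sqrrN expr1n mul1r].
  - by rewrite /dot /vx /vy !mxE !mulN1r !mulrN -opprD oppr_ge0.
  exists K; split=> //; move: Kv; rewrite -scalemxAr lineZ ?oppr_eq0 ?oner_eq0 //.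
  exact: orbit_neq0 up uv.
have [v0 c] := uv; have [cu u0 p0] := up.
pose w (t : R) := (1 - t) *: u + t *: v.
have nw t : nV (w t) = (1 - t) ^+ 2 * nV u + 2 * (t * (1 - t) * dot u v) + t ^+ 2 * nV v.
  by rewrite /w; move: (u) (v); apply: vec_elim => ? ?; apply: vec_elim => ? ?;
    rewrite /dot !coordE !nV_mkv; ring.
have uw t : 0 <= t <= 1 -> near_dir u (w t).
  move=> /andP[t0 t1].
  have d1 : 0 <= t * (1 - t) * dot u v by rewrite mulr_ge0 // mulr_ge0 // subr_ge0.
  have [nu nv] : 0 < nV u /\ 0 < nV v by rewrite !nV_gt0.
  have a1 : 0 <= (1 - t) ^+ 2 * nV u by rewrite mulr_ge0 ?sqr_ge0 ?nV_ge0.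
  have a2 : 0 <= t ^+ 2 * nV v by rewrite mulr_ge0 ?sqr_ge0 ?nV_ge0.
  split.
    rewrite -nV_gt0 nw; have [t2|t2] := eqVneq t 0.
      by rewrite t2; lra.
    have : 0 < t ^+ 2 * nV v by rewrite mulr_gt0 // exprn_even_gt0.
    lra.
  (* Only the [v] part contributes to [crs], while [0 <= dot u v] gives nV (w t) >= t^2 nV v; the
     angle condition thus passes from [v] to [w t]. *)
  have -> : crs u (w t) = t * crs u v.
    by rewrite /w; move: (u) (v); apply: vec_elim => ? ?; apply: vec_elim => ? ?;
      rewrite /crs !coordE; ring.
  rewrite exprMn; apply: (@le_trans _ _ (t ^+ 2 * (k ^+ 2 / 8 * (nV u * nV v)))).
    by rewrite ler_wpM2l ?sqr_ge0.
  have -> : t ^+ 2 * (k ^+ 2 / 8 * (nV u * nV v)) = k ^+ 2 / 8 * nV u * (t ^+ 2 * nV v) by ring.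
  rewrite [in leRHS]mulrA; apply: ler_wpM2l; last by rewrite nw; lra.
  by rewrite mulr_ge0 ?nV_ge0 // divr_ge0 // sqr_ge0.
have pw t : 0 <= t <= 1 -> P *m w t != 0 by move=> /uw; exact: (orbit_neq0 cP P0 up).
exists [set line (P *m w t) | t in `[0, 1]]; split.
- apply: connected_continuous_connected; first exact: segment_connected.
  apply: continuous_in_subspaceT => t; rewrite inE /= in_itv /= => t01.
  apply: (@cvg_line _ _ (nbhs t)); first exact: pw.
  apply: (@cvg_mulmx _ _ (nbhs t)); first exact: cst_continuous.
  apply: (@cvgD _ _ _ (nbhs t)); apply: (@cvgZr_tmp _ _ _ (nbhs t)).
    by apply: (@cvgB _ _ _ (nbhs t)); [exact: cst_continuous | exact: cvg_id].
  exact: cvg_id.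
- move=> z [t]; rewrite /= in_itv /= => t01 <-.
  by exists P, u, p, (w t); split=> //; exact: uw.
- exists 0; first by rewrite /= in_itv /= lexx ler01.
  by rewrite /w subr0 scale1r scale0r addr0.
exists 1; first by rewrite /= in_itv /= lexx ler01.
by rewrite /w subrr scale1r scale0r add0r.
Qed.

(** The path ends at the line of [P *m u], which is the image of the rank-one element
    [P *m outer u p] and so belongs to [Xu A]. *)
Lemma orbit_cone_component x : orbit_cone x ->
  connected_component orbit_cone x `&` Xu A !=set0.
Proof.
move=> [P [u [p [v [cP P0 up uv ->]]]]].
have [K [cK KD Ku Kv]] := orbit_cone_path cP P0 up uv.
have [cu u0 p0] := up.
have Pu0 : P *m u != 0 by apply: orbit_neq0 up _ => //; exact: near_dir_refl.
have [cPu _ _] := unstable_dir_image cP up Pu0.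
exists (line (P *m u)); split; first exact: (connected_component_max Kv KD cK).
exact: (ccone_Xu k0 Ak cPu).
Qed.

Lemma orbit_cone_spread : spread (k ^+ 2 / 32) orbit_cone.
Proof.
move=> x [P [u [p [v [cP P0 up uv ->]]]]].
have [K [cK KD Ku Kv]] := orbit_cone_path cP P0 up uv.
have [cu u0 p0] := up.
have Pu0 : P *m u != 0 by apply: orbit_neq0 up _ => //; exact: near_dir_refl.
have up' := unstable_dir_image cP up Pu0.
set w := P *m u in Ku Pu0 up'.
have k2 : 0 < k ^+ 2 := k2p; have k2' : k ^+ 2 <= 1 / 4 := k2h.
(* The tangent of the angle from [w] to [w1] is k / 4, so its squared sine lies between k^2 / 32 and
   k^2 / 8: large enough for the spread, small enough for [near_dir]. *)
pose w1 := w + (k / 4) *: orth w.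
have nw0 : 0 < nV w by rewrite nV_gt0.
have nw : nV w1 = (1 + k ^+ 2 / 16) * nV w.
  by rewrite /w1; move: (w); apply: vec_elim => ? ?; rewrite /orth !coordE !nV_mkv; field.
have cw : crs w w1 = k / 4 * nV w.
  by rewrite /w1; move: (w); apply: vec_elim => ? ?; rewrite /crs /orth !coordE !nV_mkv; ring.
have w10 : w1 != 0 by rewrite -nV_gt0 nw mulr_gt0 //; lra.
have E : (k / 4 * nV w) ^+ 2 = k ^+ 2 / 16 * (nV w * nV w) by field.
have ww : 0 < nV w * nV w by rewrite mulr_gt0.
have ww1 : near_dir w w1.
  split=> //; rewrite cw nw E.
  have -> : k ^+ 2 / 8 * (nV w * ((1 + k ^+ 2 / 16) * nV w)) =
     k ^+ 2 / 8 * (1 + k ^+ 2 / 16) * (nV w * nV w) by ring.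
  rewrite ler_pM2r //; have : 0 <= k ^+ 2 * k ^+ 2 by rewrite mulr_ge0 ?sqr_ge0.
  lra.
have c1 : ccone A 1%:M by exact/cone_ccone/cone1.
have n1 : (1%:M : 'M[R]_2) != 0 by rewrite -nM_gt0 nM1.
have [K' [cK' KD' Kw Kw1]] := orbit_cone_path c1 n1 up' ww1.
rewrite !mul1mx in Kw Kw1.
exists (K `|` K'), w, w1; split.
- by apply: connectedU => //; exists (line w).
- by move=> z [/KD|/KD'].
- by left.
split=> //; [by left | by right |].
rewrite cw nw E.
have -> : k ^+ 2 / 32 * (nV w * ((1 + k ^+ 2 / 16) * nV w)) =
     k ^+ 2 / 32 * (1 + k ^+ 2 / 16) * (nV w * nV w) by ring.
rewrite ler_pM2r //; have : k ^+ 2 * k ^+ 2 <= k ^+ 2 * (1 / 4) by rewrite ler_pM2l.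
lra.
Qed.

(** All conditions are homogeneous, so [P], [u], [p], [v] may be normalised; the set is then a
    continuous image of a compact set of quadruples. *)
Lemma orbit_cone_closed : closed orbit_cone.
Proof.
pose SM := ccone A `&` [set P | nM P = 1 :> R].
pose SV := [set v : 'cV[R]_2 | nV v = 1].
have cSM : compact SM by exact: compact_ccone_sphere.
have nVc : continuous (@nV R) by move=> v; apply: (@cvg_nV _ _ (nbhs v)); exact: cvg_id.
have c1 (x : R) (T : topologicalType) : continuous (fun _ : T => x) by exact: cst_continuous.
have cSV : compact SV.
  apply: compact_vec => [|v -> //].
  have -> : SV = [set v | nV v <= 1] `&` [set v : 'cV[R]_2 | 1 <= nV v].
    apply/seteqP; split=> v; first by rewrite /SV /= => ->.
    by move=> [h1 h2]; apply/eqP; rewrite eq_le h1.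
  by apply: closedI; [exact: (closed_le_fun nVc (c1 1 _)) | exact: (closed_le_fun (c1 1 _) nVc)].
pose T : topologicalType := (('M[R]_2 * 'cV[R]_2) * ('cV[R]_2 * 'cV[R]_2))%type.
have t11 : continuous (fun x : T => x.1.1).
  by move=> x; apply: (@cvg_comp _ _ _ fst fst (nbhs x)); [exact: cvg_fst|exact: cvg_fst].
have t12 : continuous (fun x : T => x.1.2).
  by move=> x; apply: (@cvg_comp _ _ _ fst snd (nbhs x)); [exact: cvg_fst|exact: cvg_snd].
have t21 : continuous (fun x : T => x.2.1).
  by move=> x; apply: (@cvg_comp _ _ _ snd fst (nbhs x)); [exact: cvg_snd|exact: cvg_fst].
have t22 : continuous (fun x : T => x.2.2).
  by move=> x; apply: (@cvg_comp _ _ _ snd snd (nbhs x)); [exact: cvg_snd|exact: cvg_snd].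
pose K : set T := ((SM `*` SV) `*` (SV `*` SV)) `&`
  ([set x : T | ccone A (outer x.1.2 x.2.1)] `&`
   [set x : T | crs x.1.2 x.2.2 ^+ 2 <= k ^+ 2 / 8]).
have cK : compact K.
  have cB : compact ((SM `*` SV) `*` (SV `*` SV)) by do !apply: compact_setX.
  apply: (@subclosed_compact _ _ ((SM `*` SV) `*` (SV `*` SV))) => //; last by move=> x [].
  apply: closedI; first by apply: compact_closed cB; exact: norm_hausdorff.
  apply: closedI.
    apply: (closed_preimage (f := fun x : T => outer x.1.2 x.2.1)); last exact: closed_ccone.
    by move=> x; apply: (@cvg_outer _ _ (nbhs x)); [exact: t12 | exact: t21].
  apply: (closed_le_fun (f := fun x : T => crs x.1.2 x.2.2 ^+ 2) _ (c1 _ _)) => x.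
  by apply: (@cvg_comp _ _ _ (fun x : T => crs x.1.2 x.2.2) (fun y => y ^+ 2) (nbhs x));
    [apply: (@cvg_crs _ _ (nbhs x)); [exact: t12 | exact: t22] | exact: exprn_continuous].
have KD x : K x -> [/\ ccone A x.1.1, x.1.1 != 0, unstable_dir x.1.2 x.2.1 & near_dir x.1.2 x.2.2].
  case: x => [[P u] [p v]] [[[[cP nP] nu] [np nv]] [/= cu uv]].
  rewrite /SV /= in nP nu np nv.
  split=> //; first by rewrite -nM_gt0 nP.
    by split=> //; rewrite -nV_gt0 ?nu ?np.
  by split; [rewrite -nV_gt0 nv | rewrite nu nv !mulr1].
suff -> : orbit_cone = [set line (x.1.1 *m x.2.2) | x in K].
  apply: compact_closed; first exact: norm_hausdorff.
  apply: continuous_compact cK; apply: continuous_in_subspaceT => x /set_mem /KD[cP P0 up uv].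
  apply: (@cvg_line _ _ (nbhs x)); first exact: orbit_neq0 up uv.
  by apply: (@cvg_mulmx _ _ (nbhs x)); [exact: t11 | exact: t22].
apply/seteqP; split=> z; last first.
  by move=> [x /KD[cP P0 up uv] <-]; exists x.1.1, x.1.2, x.2.1, x.2.2; split.
move=> [P [u [p [v [cP P0 up uv ->]]]]].
have Pv0 := orbit_neq0 cP P0 up uv.
have [cu u0 p0] := up; have [v0 c] := uv.
have normV (w : 'cV[R]_2) : w != 0 -> nV ((Num.sqrt (nV w))^-1 *: w) = 1.
  by rewrite -nV_gt0 => w0; rewrite nVZ exprVn sqr_sqrtr ?nV_ge0 // mulVf ?gt_eqF.
have scV (w : 'cV[R]_2) : w != 0 -> (Num.sqrt (nV w))^-1 != 0.
  by rewrite -nV_gt0 => w0; rewrite invr_eq0 gt_eqF // sqrtr_gt0.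
have nP : 0 < nM P by rewrite nM_gt0.
pose N (w : 'cV[R]_2) := (Num.sqrt (nV w))^-1 *: w.
exists (((Num.sqrt (nM P))^-1 *: P, N u), (N p, N v)).
  split.
    split; split; rewrite /= /SV /=; try exact: normV.
    split; first exact: ccone_scale.
    by rewrite /= nMZ exprVn sqr_sqrtr ?nM_ge0 // mulVf ?gt_eqF.
  split; rewrite /=.
    have -> : outer (N u) (N p) = ((Num.sqrt (nV u))^-1 * (Num.sqrt (nV p))^-1) *: outer u p.
      rewrite /N; move: (Num.sqrt _)^-1 (Num.sqrt _)^-1 => x y; move: (u) (p).
      by apply: vec_elim => ? ?; apply: vec_elim => ? ?; rewrite /outer !coordE; congr M4; ring.
    exact: ccone_scale.
  have [nu nv] : 0 < nV u /\ 0 < nV v by rewrite !nV_gt0.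
  rewrite crsZl crsZr !exprMn !exprVn !sqr_sqrtr ?nV_ge0 //.
  by rewrite mulrA -invfM mulrC ler_pdivrMr ?mulr_gt0.
rewrite /= -scalemxAl -scalemxAr scalerA lineZ //.
by rewrite mulf_neq0 ?scV // invr_eq0 gt_eqF // sqrtr_gt0.
Qed.

Lemma stable_unstable a s : semigroup A a -> is_s a s ->
  exists w, [/\ ccone A (outer w (orth s)), w != 0 & s != 0].
Proof.
move=> Sa [l [l' [w [[s0 as_] [w0 aw] ll]]]]; exists w; split=> //.
exact: ccone_proximal Sa aw as_ ll.
Qed.

(** An unstable eigenvector of a proximal element is itself the image of a rank-one limit, by
    [ccone_proximal]. *)
Lemma Xu_near_line x e : Xu A x -> 0 < e ->
  exists u p, [/\ unstable_dir u p, `|x.1 - (line u).1| < e & `|x.2 - (line u).2| < e].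
Proof.
move=> Xx e0; have [z [[u [a Sa [l [l' [w [[u0 au] [w0 aw] ll]]]]] <-] [h1 h2]]] :=
  Xx _ (nbhsx_ballx x _ e0).
exists u, (orth w); split=> //; split=> //; first exact: ccone_proximal Sa au aw ll.
by move: w0; rewrite -!nV_gt0 nV_mkv sqrrN addrC.
Qed.

Lemma orbit_cone_line_dist P u p v s w : ccone A P -> P != 0 -> unstable_dir u p ->
  near_dir u v -> ccone A (outer w (orth s)) -> w != 0 -> s != 0 ->
  k ^+ 2 <= ((line s).1 - (line (P *m v)).1) ^+ 2 + ((line s).2 - (line (P *m v)).2) ^+ 2.
Proof.
move=> cP P0 up uv cw w0 s0; have Pv0 := orbit_neq0 cP P0 up uv.
rewrite line_dist //; have [cu u0 p0] := up; have [v0 c] := uv.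
have h := outer_cone_transversality k0 Ak cP cu p0 u0 cw w0 c.
rewrite ler_pdivlMr ?mulr_gt0 ?nV_gt0 //.
have h2 := nV_mul P v.
have : k ^+ 2 * (nV s * nV (P *m v)) <= k ^+ 2 * (nV s * (nM P * nV v)).
  by rewrite ler_wpM2l ?sqr_ge0 // ler_wpM2l ?nV_ge0.
by lra.
Qed.

Lemma orbit_cone_Xs : orbit_cone `&` Xs A = set0.
Proof.
apply/seteqP; split=> // x [[P [u [p [v [cP P0 up uv xE]]]]] Xx].
(* Errors below k / 2 in both coordinates give squared distance below k^2 / 2, against the lower
   bound k^2 of [orbit_cone_line_dist]. *)
have e0 : 0 < k / 2 by rewrite divr_gt0 // kp.
have [z [[s [a Sa ss] <-] [h1 h2]]] := Xx _ (nbhsx_ballx x _ e0).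
have [w [cw w0 s0]] := stable_unstable Sa ss.
have := orbit_cone_line_dist cP P0 up uv cw w0 s0; rewrite -xE.
apply/negP; rewrite -ltNge.
have sq (y y' : R) : `|y - y'| < k / 2 -> (y' - y) ^+ 2 < k ^+ 2 / 4.
  move=> h; have -> : k ^+ 2 / 4 = (k / 2) ^+ 2 by field.
  by rewrite -real_normK ?num_real // distrC ltr_sqr ?nnegrE // ltW.
have := sq _ _ h1; have := sq _ _ h2.
have k2 : 0 < k ^+ 2 := k2p; lra.
Qed.

Lemma S1_closed : closed (@S1 R).
Proof.
have c : continuous (fun z : R * R => z.1 * z.1 + z.2 * z.2).
  move=> z; apply: (@cvgD _ _ _ (nbhs z)); apply: (@cvgM _ _ (nbhs z));
  by first [exact: cvg_fst | exact: cvg_snd].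
have c1 : continuous (fun z : R * R => 1 : R) by exact: cst_continuous.
have -> : @S1 R = [set z | z.1 * z.1 + z.2 * z.2 <= 1] `&` [set z | 1 <= z.1 * z.1 + z.2 * z.2].
  apply/seteqP; split=> z; rewrite /S1 /= !expr2; first by move=> ->.
  by move=> [h1 h2]; apply/eqP; rewrite eq_le h1.
by apply: closedI; [exact: (closed_le_fun c c1) | exact: (closed_le_fun c1 c)].
Qed.

Lemma Xu_S1 : Xu A `<=` @S1 R.
Proof.
move=> x; have -> : @S1 R = closure (@S1 R) by apply/closure_id; exact: S1_closed.
apply: closure_subset => _ [u [a _ [l [l' [w [[u0 _] _ _]]]]] <-]; exact: line_S1.
Qed.

Lemma orbit_cone_boundary : pboundary orbit_cone `&` Xu A = set0.
Proof.
apply/seteqP; split=> // x [[_ nI] Xx]; apply: nI.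
(* Two errors of k / 8 per coordinate put [y] at squared distance below k^2 / 8 from [line u], hence
   squared sine below k^2 / 32: [near_dir] holds and [P] can be the identity. *)
pose e := k / 8; have e0 : 0 < e by rewrite divr_gt0 // kp.
have [u [p [up h1 h2]]] := Xu_near_line Xx e0; have [cu u0 p0] := up.
suff H y : `|y.1 - x.1| < e -> `|y.2 - x.2| < e -> S1 y -> orbit_cone y.
  by split; [apply: H; rewrite ?subrr ?normr0 //; exact: Xu_S1 | exists e].
move=> g1 g2 Sy; have [t _ yE] := S1_line Sy.
have v0 := cossin_neq0 t; set v := mkv _ _ in v0 yE.
have c1 : ccone A 1%:M by exact/cone_ccone/cone1.
have n1 : (1%:M : 'M[R]_2) != 0 by rewrite -nM_gt0 nM1.
exists 1%:M, u, p, v; split; rewrite ?mul1mx //; split=> //.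
have sq (a b c : R) : `|a - b| < e -> `|c - a| < e -> (b - c) ^+ 2 < k ^+ 2 / 16.
  move=> l1 l2; have -> : k ^+ 2 / 16 = (2 * e) ^+ 2 by rewrite /e; field.
  rewrite -real_normK ?num_real // distrC ltr_sqr ?nnegrE //; last by lra.
  by apply: le_lt_trans (ler_distD a c b) _; lra.
have d1 := sq _ _ _ h1 g1; have d2 := sq _ _ _ h2 g2.
have := line_dist u0 v0; rewrite -yE => dE.
have n0 : 0 < nV u * nV v by rewrite mulr_gt0 ?nV_gt0.
have : 4 * crs u v ^+ 2 / (nV u * nV v) < k ^+ 2 / 8 by rewrite -dE; lra.
rewrite ltr_pdivrMr //; have := sqr_ge0 (crs u v); lra.
Qed.

Lemma orbit_cone_unstable_multicone : unstable_multicone A orbit_cone.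
Proof.
have [u [p up]] := unstable_dir_exists; have [cu u0 p0] := up.
have [a Sa pa] := ccone_proximal_exists k0 Ak cu u0 p0.
split; [ |by exists a|exact: orbit_cone_Xs|exact: orbit_cone_boundary|exact: orbit_cone_component].
have c1 : ccone A 1%:M by exact/cone_ccone/cone1.
have n1 : (1%:M : 'M[R]_2) != 0 by rewrite -nM_gt0 nM1.
have Du : orbit_cone (line u).
  by exists 1%:M, u, p, u; rewrite mul1mx; split=> //; exact: near_dir_refl.
split; first exact: orbit_cone_S1.
  (* A stable line of the proximal element lies on the circle but outside the set, which is
     therefore proper. *)
  have [s ss] : exists s, is_s a s.
    have [l1 [l2 [v1 [v2 [e1 e2 /eqP ne]]]]] := pa.
    by have [h|h|//] := ltgtP `|l1| `|l2|; [exists v1, l1, l2, v2 | exists v2, l2, l1, v1].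
  have [w [_ _ s0]] := stable_unstable Sa ss.
  have Xs_s : Xs A (line s) by apply: subset_closure; exists s => //; exists a.
  apply/eqP => DE; have : (orbit_cone `&` Xs A) (line s).
    by split=> //; rewrite DE; exact: line_S1.
  by rewrite orbit_cone_Xs.
have d0 : 0 < k ^+ 2 / 32 by rewrite divr_gt0 // k2p.
have [arcs [le_arcs DE]] := closed_spread_fin_arcs d0 orbit_cone_S1 orbit_cone_closed orbit_cone_spread.
exists arcs; split=> //; apply: contraTneq isT => s0.
by move: Du; rewrite DE s0 => -[].
Qed.

End Multicone.

Theorem theorem2p1 (R : realType) (A : set 'M[R]_2)
  (hGL : forall a, A a -> a \in unitmx)
  (hAM : almost_multiplicative (semigroup A)) :
  let P1 := strongly_conformal A in
  let P2 := (exists C, invariant_for A C /\ unstable_multicone A C) /\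
            ~ (exists2 a, semigroup A a & parabolic a) in
  (P1 /\ ~ P2) \/ (~ P1 /\ P2).
Proof.
move=> P1 P2.
have [k k0 Ak] := almost_multiplicative_nM hAM.
(* An unstable multicone comes with a proximal element, which strong conformality excludes. *)
have excl : P1 -> ~ P2.
  by move=> p1 [[C [_ [_ prox _ _ _]]] _]; exact: strongly_conformal_not_proximal p1 prox.
have [sing|nsing] := pselect (exists P, [/\ ccone A P, P != 0 & \det P = 0]).
  right; suff p2 : P2 by split=> // p1; exact: excl p1 p2.
  split.
    exists (orbit_cone A k); split; first exact: orbit_cone_invariant.
    exact: orbit_cone_unstable_multicone.
  have /andP[kp _] := k0.
  by apply: (sg_no_parabolic kp hGL) => a b Sa Sb; apply: Ak; left.
left; suff p1 : P1 by split=> //; exact: excl.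
have nz P : ccone A P -> P != 0 -> \det P != 0.
  by move=> cP P0; apply/eqP => dP; apply: nsing; exists P.
have [q [d0 x0 z0 H]] := conformal_form hGL (ccone_det_bound hGL nz).
exact: strongly_conformal_of_form d0 x0 z0 H.
Qed.
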